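(* (Explicit formula for the damage energy.) Let $\mathbf{u}\in C^2([0,T];X)$ be the solution of $$\rho\,\ddot{\mathbf{u}}(t,\mathbf{x})+\mathcal{L}^\epsilon[\mathbf{u}](t,\mathbf{x})=\mathbf{b}(t,\mathbf{x}),\qquad \mathbf{u}(0)=\mathbf{u}_0,\quad \dot{\mathbf{u}}(0)=\mathbf{v}_0,$$ with $\mathbf{u}_0,\mathbf{v}_0\in X$ and $\mathbf{b}\in C([0,T];X)$, where $\gamma$ is either of the degradation factors (a), (b) of the context. Then for every $t\in[0,T]$ the damage energy $$\mathcal{D}^\epsilon(t)=-\int_0^t\int_\Omega\int_\Omega\rho^\epsilon(\mathbf{y},\mathbf{x})\,\partial_t\gamma(\mathbf{u})(\mathbf{y},\mathbf{x},\tau)\,g(r(\tau,\mathbf{u}))\,d\mathbf{y}\,d\mathbf{x}\,d\tau$$ is given by $$\mathcal{D}^\epsilon(t)=\int_\Omega\int_\Omega\rho^\epsilon(\mathbf{y},\mathbf{x})\,C^+\,\big(1-\gamma(\mathbf{u})(\mathbf{y},\mathbf{x},t)\big)\,d\mathbf{y}\,d\mathbf{x}.$$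
   Context: Let $d\in\{2,3\}$, $\Omega\subset\mathbb{R}^d$ a bounded domain, $T>0$, $\epsilon>0$ and $\rho>0$ constants. Let $\omega_d$ be the volume of the unit ball of $\mathbb{R}^d$ and $V_d^\epsilon=\omega_d\epsilon^d$. Function space: $\mathcal{U}=\{\mathbf{w}:\mathbf{w}(\mathbf{x})=\mathbb{Q}\mathbf{x}+\mathbf{c},\ \mathbb{Q}\in\mathbb{R}^{d\times d},\ \mathbb{Q}^T=-\mathbb{Q},\ \mathbf{c}\in\mathbb{R}^d\}$, and $X=\{\mathbf{u}\in L^\infty(\Omega;\mathbb{R}^d):\int_\Omega\mathbf{u}\cdot\mathbf{w}\,d\mathbf{x}=0\ \text{for all }\mathbf{w}\in\mathcal{U}\}$ with the $L^\infty$ norm. Kernel: $\rho^\epsilon(\mathbf{y},\mathbf{x})=\chi_\Omega(\mathbf{y})J(|\mathbf{y}-\mathbf{x}|/\epsilon)/(\epsilon V_d^\epsilon)$, where $\chi_\Omega$ is the characteristic function of $\Omega$ and $J:[0,\infty)\to[0,\infty)$ is decreasing, positive on $[0,1)$, with $J(0)=M<\infty$ and $J=0$ on $[1,\infty)$. Strain: $\mathbf{e}=(\mathbf{y}-\mathbf{x})/|\mathbf{y}-\mathbf{x}|$, $S(\mathbf{y},\mathbf{x},\mathbf{u}(t))=\frac{\mathbf{u}(t,\mathbf{y})-\mathbf{u}(t,\mathbf{x})}{|\mathbf{y}-\mathbf{x}|}\cdot\mathbf{e}$, and $r(t,\mathbf{u})=\sqrt{|\mathbf{y}-\mathbf{x}|}\,S(\mathbf{y},\mathbf{x},\mathbf{u}(t))$.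 Potential: there are constants $r^-<r^e<0<r^c<r^+$; $g:\mathbb{R}\to\mathbb{R}$ is $C^2$, with $g',g''$ bounded, $g=C^-$ for $r\le r^-$, $g=C^+$ for $r\ge r^+$; $g$ is convex on $[r^e,r^c]$ and concave otherwise (on $(-\infty,r^e]$ away from the constant part, i.e. on $[r^-,r^e]$, and on $[r^c,r^+]$). Degradation factor, one of the following: (a) $\gamma(\mathbf{u})(\mathbf{y},\mathbf{x},t)=h\big(\int_0^t(r(\tau,\mathbf{u})-r^+)^+\,d\tau\big)$, where $(\cdot)^+$ is the positive part and $h\ge 0$ is smooth, equal to $1$ for negative arguments, decreasing to zero on $[0,x^D)$, and zero on $[x^D,\infty)$, for some $x^D>0$; (b) $\gamma(\mathbf{u})(\mathbf{y},\mathbf{x},t)=h\big(\sqrt{|\mathbf{y}-\mathbf{x}|}\,S^*(t,\mathbf{y},\mathbf{x},\mathbf{u})\big)$, where $S^*(t,\mathbf{y},\mathbf{x},\mathbf{u})=\max_{0\le\tau\le t}S(\mathbf{y},\mathbf{x},\mathbf{u}(\tau))$ and $h\ge0$ is smooth, equal to $1$ on $(-\infty,r^+]$, decreasing to zero on $[r^+,r^D]$, and zero on $[r^D,\infty)$, for some $r^D>r^+$. (In case (b), for the solution $\mathbf u$, $\gamma(\mathbf u)(\mathbf y,\mathbf x,\cdot)$ is Lipschitz in time and $\partial_t\gamma$ is its a.e. derivative.) Force density: $\mathcal{L}^\epsilon[\mathbf{u}](t,\mathbf{x})=-\int_\Omega\frac{2\rho^\epsilon(\mathbf{y},\mathbf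{x})}{\sqrt{|\mathbf{y}-\mathbf{x}|}}\,\gamma(\mathbf{u})(\mathbf{y},\mathbf{x},t)\,g'(r(t,\mathbf{u}))\,\mathbf{e}\,d\mathbf{y}$.
   Formalization: For the degradation factor (b) it is additionally assumed that the body is initially undamaged, γ(u)(y,x,0)=1 for almost every bond in Ω with |y−x|<ε; without this the formula already fails at t=0 when C^+≠0. *)

(* Defs.v *)
From HB Require Import structures.
From mathcomp Require Import all_boot all_order all_algebra.
From mathcomp Require Import all_classical all_reals all_analysis.

Set Implicit Arguments.
Unset Strict Implicit.
Unset Printing Implicit Defensive.

Import Order.TTheory GRing.Theory Num.Theory.
Import numFieldNormedType.Exports.

Local Open Scope classical_set_scope.
Local Open Scope ring_scope.

(* The sigma-algebra on ['rV[R]_n] is generated by the coordinates (hence is the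
   Borel one); this mirrors the library instance on [n.-tuple T]. *)
Section measurable_rV.
Context {R : realType} (n : nat).

Definition rV_coord (i : 'I_n) (x : 'rV[R]_n) : measurableTypeR R := x ord0 i.

Let rV_set0 : g_sigma_preimage rV_coord set0.
Proof. exact: sigma_algebra0. Qed.

Let rV_setC A : g_sigma_preimage rV_coord A -> g_sigma_preimage rV_coord (~` A).
Proof. exact: sigma_algebraC. Qed.

Let rV_bigcup (F : (set 'rV[R]_n)^nat) :
  (forall i, g_sigma_preimage rV_coord (F i)) ->
  g_sigma_preimage rV_coord (\bigcup_i (F i)).
Proof. exact: sigma_algebra_bigcup. Qed.

HB.instance Definition _ := @isMeasurable.Build
  (measure_tuple_display default_measure_display)
  'rV[R]_n (g_sigma_preimage rV_coord) rV_set0 rV_setC rV_bigcup.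

End measurable_rV.

Section rV_measurability.
Context {R : realType}.

Lemma measurable_rV_coord n (i : 'I_n) :
  measurable_fun [set: 'rV[R]_n] (rV_coord i).
Proof.
move=> _ Y mY; rewrite setTI; apply: sub_sigma_algebra => /=.
rewrite -bigcup_seq/=; exists i => /=; first by rewrite mem_index_enum.
by exists Y => //; rewrite setTI.
Qed.

Lemma measurable_fun_rVP d (T : measurableType d) n (f : T -> 'rV[R]_n) :
  measurable_fun [set: T] f <->
  forall i, measurable_fun [set: T] (rV_coord i \o f).
Proof.
split=> [mf i|mf].
  by apply: measurableT_comp => //; exact: measurable_rV_coord.
suff H : g_sigma_preimage (fun i => rV_coord i \o f) `<=` measurable.
  by rewrite g_sigma_preimage_comp in H; move=> _ A mA; apply: H; exists A.
apply: smallest_sub; first exact: sigma_algebra_measurable.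
case: n => [|n] in f mf *; first by rewrite big_ord0.
rewrite -bigcup_mkord_ord; apply: bigcup_sub => i Ii.
by move=> A [B mB <-]; exact: mf.
Qed.

Definition rV_cons n (p : 'rV[R]_n * measurableTypeR R) : 'rV[R]_n.+1 :=
  \row_i (if unlift ord0 i is Some j then p.1 ord0 j else p.2).

Definition rV_uncons n (v : 'rV[R]_n.+1) : 'rV[R]_n * measurableTypeR R :=
  (\row_j v ord0 (lift ord0 j), v ord0 ord0).

Lemma rV_consK n : cancel (@rV_cons n) (@rV_uncons n).
Proof.
move=> [v a]; rewrite /rV_uncons /rV_cons !mxE unlift_none; congr (_, _).
by apply/rowP => j; rewrite !mxE liftK.
Qed.

Lemma measurable_rV_cons n : measurable_fun setT (@rV_cons n).
Proof.
apply/measurable_fun_rVP => i.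
rewrite (_ : _ \o _ = fun p => if unlift ord0 i is Some j
  then rV_coord j p.1 else p.2); last first.
  by apply/funext => p; rewrite /= /rV_coord !mxE; case: unliftP.
case: unliftP => [j|] _; last exact: measurable_snd.
by apply: (measurableT_comp (measurable_rV_coord j)); exact: measurable_fst.
Qed.

Lemma measurable_rV_uncons n : measurable_fun setT (@rV_uncons n).
Proof.
apply/measurable_fun_pairP; split; last exact: (measurable_rV_coord ord0).
apply/measurable_fun_rVP => i.
rewrite (_ : _ \o _ = rV_coord (lift ord0 i)); first exact: measurable_rV_coord.
by apply/funext => v; rewrite /= /rV_coord mxE.
Qed.

Section lebesgue_rV_step.
Variables (n : nat) (mu : {sigma_finite_measure set 'rV[R]_n -> \bar R}).

Definition lebesgue_rVS : set 'rV[R]_n.+1 -> \bar R :=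
  pushforward (mu \x lebesgue_measure)%E (@rV_cons n).

HB.instance Definition _ :=
  isMeasurableFun.Build _ _ _ _ (@rV_cons n) (@measurable_rV_cons n).

Let lebesgue_rVS0 : lebesgue_rVS set0 = 0%E.
Proof. exact: measure0. Qed.

Let lebesgue_rVS_ge0 A : (0 <= lebesgue_rVS A)%E.
Proof. exact: measure_ge0. Qed.

Let lebesgue_rVS_sigma_additive : semi_sigma_additive lebesgue_rVS.
Proof.
exact: (@measure_semi_sigma_additive _ _ _
  (pushforward (mu \x lebesgue_measure)%E (@rV_cons n))).
Qed.

HB.instance Definition _ := isMeasure.Build _ _ _ lebesgue_rVS
  lebesgue_rVS0 lebesgue_rVS_ge0 lebesgue_rVS_sigma_additive.

Let lebesgue_rVS_sigma_finite : sigma_finite setT lebesgue_rVS.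
Proof.
have /sigma_finiteP[F [TF ndF Foo]] := sigma_finiteT mu.
have /sigma_finiteP[G [TG ndG Goo]] := sigma_finiteT (@lebesgue_measure R).
exists (fun k => @rV_uncons n @^-1` (F k `*` G k)).
  rewrite -preimage_bigcup (_ : \bigcup_k _ = setT) ?preimage_setT//.
  rewrite -setXTT TF TG predeqE => -[x y]; split.
    by move=> [k _ []/= ? ?]; split; exists k.
  move=> [/= [k _ Fkx] [l _ Gly]]; exists (maxn k l) => //; split.
  - by move: x Fkx; exact/subsetPset/ndF/leq_maxl.
  - by move: y Gly; exact/subsetPset/ndG/leq_maxr.
move=> k; have [mFk Fk] := Foo k; have [mGk Gk] := Goo k; split.
  rewrite -[X in measurable X]setTI; apply: measurable_rV_uncons => //.
  exact: measurableX.
rewrite /lebesgue_rVS /pushforward -comp_preimage.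
rewrite (_ : _ \o _ = id) ?preimage_id; last first.
  by apply/funext => p /=; rewrite rV_consK.
by rewrite product_measure1E// lte_mul_pinfty// ge0_fin_numE.
Qed.

HB.instance Definition _ := Measure_isSigmaFinite.Build _ _ _
  lebesgue_rVS lebesgue_rVS_sigma_finite.

End lebesgue_rV_step.

(* Lebesgue measure on R^n, as the image of the iterated product of the
   one-dimensional one; [lebesgue_rV_box] characterizes it. *)
Fixpoint lebesgue_rV n : {sigma_finite_measure set 'rV[R]_n -> \bar R} :=
  match n with
  | 0 => [the {sigma_finite_measure set 'rV[R]_0 -> \bar R} of dirac (0 : 'rV[R]_0)]
  | m.+1 => [the {sigma_finite_measure set 'rV[R]_m.+1 -> \bar R} of
               lebesgue_rVS (lebesgue_rV m)]
  end.

Lemma lebesgue_rV_box n (a b : 'rV[R]_n) :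
  (forall i, a ord0 i <= b ord0 i) ->
  lebesgue_rV n [set x : 'rV[R]_n | forall i, x ord0 i \in `[a ord0 i, b ord0 i]] =
  (\prod_(i < n) (b ord0 i - a ord0 i))%:E.
Proof.
elim: n a b => [|n IH] a b ab.
  rewrite big_ord0 (_ : [set x | _] = setT); first exact: diracT.
  by apply/seteqP; split=> // x _ [].
pose a' := \row_(j < n) a ord0 (lift ord0 j).
pose b' := \row_(j < n) b ord0 (lift ord0 j).
set S := [set x | _]; rewrite -[LHS]/(lebesgue_rVS (lebesgue_rV n) S).
rewrite /lebesgue_rVS /pushforward.
rewrite (_ : _ @^-1` S = [set x : 'rV[R]_n | forall i, x ord0 i \in `[a' ord0 i, b' ord0 i]]
   `*` [set` `[a ord0 ord0, b ord0 ord0]]); last first.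
  apply/seteqP; split=> -[v t] /=.
    move=> H; split=> [i|].
      by have := H (lift ord0 i); rewrite /rV_cons !mxE liftK.
    by have := H ord0; rewrite /rV_cons !mxE unlift_none.
  by move=> [H1 H2] i; rewrite /rV_cons !mxE; case: unliftP => [j ->|->//];
    have := H1 j; rewrite !mxE.
rewrite product_measure1E//; last first.
  rewrite (_ : [set x | _] = \bigcap_(i in [set: 'I_n])
     (rV_coord i @^-1` [set` `[a' ord0 i, b' ord0 i]])); last first.
    by apply/seteqP; split=> [x H i _|x H i]; [exact: H|exact: (H i)].
  apply: fin_bigcap_measurable => // i _.
  by rewrite -[X in measurable X]setTI; exact: measurable_rV_coord.
transitivity ((\prod_(i < n) (b' ord0 i - a' ord0 i))%:E *
    (b ord0 ord0 - a ord0 ord0)%:E)%E.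
  congr (_ * _)%E; first by apply: IH => i; rewrite !mxE.
  rewrite [LHS]lebesgue_measure_itv/= lte_fin.
  by have := ab ord0; rewrite le_eqVlt => /orP[/eqP->|->]; rewrite ?ltxx ?subrr.
rewrite big_ord_recl mulrC EFinM; congr (_%:E * _)%E.
by apply: eq_bigr => i _; rewrite !mxE.
Qed.

End rV_measurability.

Section model.
Context {R : realType} {d : nat}.
Local Notation E := 'rV[R]_d.
Local Notation vol := (lebesgue_rV (R := R) d).
Local Notation dt := (@lebesgue_measure R).

Definition dotp (x y : E) : R := \sum_i x ord0 i * y ord0 i.

(* The norm [`|x|] of the library on ['rV[R]_d] is the sup norm, whence: *)
Definition enorm (x : E) : R := Num.sqrt (dotp x x).

Definition bounded_domain (Omega : set E) : Prop :=
  [/\ Omega !=set0, open Omega, connected Omega & bounded_set Omega].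

Definition Linfty_norm (Omega : set E) (w : E -> E) : \bar R :=
  'N[vol]_+oo[ (fun x => (enorm (w x))%:E) \_ Omega ].

Definition in_Linfty (Omega : set E) (w : E -> E) : Prop :=
  measurable_fun Omega w /\ (Linfty_norm Omega w < +oo)%E.

Definition infinitesimal_rigid (w : E -> E) : Prop :=
  exists (Q : 'M[R]_d) (c : E), Q^T = - Q /\ w = (fun x => x *m Q^T + c).

Definition in_X (Omega : set E) (w : E -> E) : Prop :=
  in_Linfty Omega w /\
  forall z, infinitesimal_rigid z -> \int[vol]_(x in Omega) dotp (w x) (z x) = 0.

(* Curves in X are given by representatives [f : R -> E -> E], only the values
   at times in [0, T] being relevant; limits are in the L^oo norm. *)
Definition C0_X (Omega : set E) (T : R) (f : R -> E -> E) : Prop :=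
  forall t, t \in `[0, T] -> in_X Omega (f t) /\
    Linfty_norm Omega (fun x => f s x - f t x)
      @[s --> within [set` `[0, T]] (nbhs t)] --> 0%E.

Definition time_derivative_X (Omega : set E) (T : R) (f f' : R -> E -> E) :
    Prop :=
  forall t, t \in `[0, T] ->
    Linfty_norm Omega (fun x => (s - t)^-1 *: (f s x - f t x) - f' t x)
      @[s --> within [set` `[0, T]] t^'] --> 0%E.

Definition C2_X (Omega : set E) (T : R) (u u' u'' : R -> E -> E) : Prop :=
  [/\ C0_X Omega T u, C0_X Omega T u', C0_X Omega T u'',
      time_derivative_X Omega T u u' & time_derivative_X Omega T u' u''].

(* A continuous curve in L^oo has a representative whose trajectories are
   continuous at almost every point, and two such representatives agree on
   [0, T] at almost every point. The time integral and the running maximum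
   in the degradation factors only make sense for such a representative. *)
Definition continuous_trajectories (Omega : set E) (T : R) (u : R -> E -> E) :
    Prop :=
  {ae vol, forall x, Omega x -> {within `[0, T], continuous (u ^~ x)}}.

Definition influence_function (J : R -> R) (M : R) : Prop :=
  [/\ forall z, 0 <= z -> 0 <= J z,
      forall z z', 0 <= z -> z <= z' -> J z' <= J z,
      forall z, 0 <= z < 1 -> 0 < J z,
      J 0 = M &
      forall z, 1 <= z -> J z = 0].

Definition unit_ball_volume : R := fine (vol [set x | enorm x < 1]).

Definition nonlocal_kernel (Omega : set E) (J : R -> R) (eps : R) (y x : E) :
    R :=
  \1_Omega y * J (enorm (y - x) / eps) / (eps * (unit_ball_volume * eps ^+ d)).

Definition direction (y x : E) : E := (enorm (y - x))^-1 *: (y - x).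

Definition strain (y x : E) (w : E -> E) : R :=
  dotp ((enorm (y - x))^-1 *: (w y - w x)) (direction y x).

Definition scaled_strain (y x : E) (w : E -> E) : R :=
  Num.sqrt (enorm (y - x)) * strain y x w.

Definition concave_on (A : set R) (g : R -> R) : Prop :=
  convex_function (E := R^o) A (fun z => - g z).

Record cohesive_potential (rm re rc rp Cm Cp : R) (g : R -> R) : Prop := {
  potential_order : [/\ rm < re, re < 0, 0 < rc & rc < rp] ;
  potential_C1 : forall z, derivable g z 1 ;
  potential_C2 : forall z, derivable (derive1 g) z 1 ;
  potential_C2_continuous : continuous (derive1n 2 g) ;
  potential_bounded1 : exists B, forall z, `|derive1 g z| <= B ;
  potential_bounded2 : exists B, forall z, `|derive1n 2 g z| <= B ;
  potential_left : forall z, z <= rm -> g z = Cm ;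
  potential_right : forall z, rp <= z -> g z = Cp ;
  potential_convex : convex_function (E := R^o) [set` `[re, rc]] g ;
  potential_concave_left : concave_on [set` `[rm, re]] g ;
  potential_concave_right : concave_on [set` `[rc, rp]] g }.

Definition smooth (h : R -> R) : Prop := forall n z, derivable (derive1n n h) z 1.

Definition degradation := (R -> E -> E) -> E -> E -> R -> R.

Definition cumulative_degradation (rp : R) (gamma : degradation) : Prop :=
  exists (h : R -> R) (xD : R),
    [/\ 0 < xD, smooth h, forall z, 0 <= h z,
        forall z, z < 0 -> h z = 1 &
        (forall z z', 0 <= z -> z <= z' -> z' < xD -> h z' <= h z) /\
        (forall z, xD <= z -> h z = 0)] /\
    gamma = fun u y x t =>
      h (\int[dt]_(tau in `[0, t])
           Num.max (scaled_strain y x (u tau) - rp) 0).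

(* The supremum is a maximum as soon as [u ^~ x] and [u ^~ y] are continuous. *)
Definition max_strain (u : R -> E -> E) (y x : E) (t : R) : R :=
  sup [set strain y x (u tau) | tau in `[0, t]].

Definition max_degradation (rp : R) (gamma : degradation) : Prop :=
  exists (h : R -> R) (rD : R),
    [/\ rp < rD, smooth h, forall z, 0 <= h z,
        forall z, z <= rp -> h z = 1 &
        (forall z z', rp <= z -> z <= z' -> z' <= rD -> h z' <= h z) /\
        (forall z, rD <= z -> h z = 0)] /\
    gamma = fun u y x t =>
      h (Num.sqrt (enorm (y - x)) * max_strain u y x t).

(* Automatic for [cumulative_degradation], since then [gamma u y x 0 = h 0]; for
   [max_degradation] it excludes bonds already stretched beyond the threshold
   by the initial displacement. *)
Definition initially_undamaged (Omega : set E) (eps : R) (gamma : degradation)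
    (u : R -> E -> E) : Prop :=
  {ae vol, forall x, Omega x ->
    {ae vol, forall y, Omega y -> enorm (y - x) < eps -> gamma u y x 0 = 1}}.

Definition force_density (Omega : set E) (J : R -> R) (eps : R) (g : R -> R)
    (gamma : degradation) (u : R -> E -> E) (t : R) (x : E) : E :=
  \row_i (- \int[vol]_(y in Omega)
    (2 * nonlocal_kernel Omega J eps y x / Num.sqrt (enorm (y - x)) *
     gamma u y x t * derive1 g (scaled_strain y x (u t)) * direction y x ord0 i)).

(* Equalities in X are equalities almost everywhere in [Omega]. *)
Record solution (Omega : set E) (T rho eps : R) (J g : R -> R)
    (gamma : degradation) (b : R -> E -> E) (u0 v0 : E -> E)
    (u u' u'' : R -> E -> E) : Prop := {
  solution_C2 : C2_X Omega T u u' u'' ;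
  solution_equation : forall t, t \in `[0, T] ->
    {ae vol, forall x, Omega x ->
      rho *: u'' t x + force_density Omega J eps g gamma u t x = b t x} ;
  solution_position : {ae vol, forall x, Omega x -> u 0 x = u0 x} ;
  solution_velocity : {ae vol, forall x, Omega x -> u' 0 x = v0 x} }.

Definition damage_energy (Omega : set E) (J : R -> R) (eps : R) (g : R -> R)
    (gamma : degradation) (u : R -> E -> E) (t : R) : R :=
  - \int[dt]_(tau in `[0, t]) \int[vol]_(x in Omega) \int[vol]_(y in Omega)
      (nonlocal_kernel Omega J eps y x * derive1 (gamma u y x) tau *
       g (scaled_strain y x (u tau))).

End model.

Arguments degradation : clear implicits.

(* Main.v *)
(* Off a null set of points, the displacement is Lipschitz in time (mean value
   inequality in L^oo, then rational times and continuity of the trajectories), so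
   each bond has a degradation factor G which is nonincreasing and Lipschitz in
   time. Where the scaled strain r is below r^+, no damage accumulates and G is
   locally constant; elsewhere g(r) = C^+. Hence g(r) G' = C^+ G' at every time,
   and it remains to integrate -G' in time first. Tonelli applies since -G' >= 0 is
   jointly measurable, and the integral in time is G(0) - G(t) by the fundamental
   theorem of calculus for monotone Lipschitz functions, obtained here from the
   Radon-Nikodym density of the Stieltjes measure of -G. Tonelli also yields the
   finiteness of the inner integrals for almost every time, which avoids estimating
   the singular factor |y - x|^(-1/2). *)

(* The obstacle is that the displacement behaves well only at almost every point and at times in
   [0, T], while measurability and Tonelli want functions that are good everywhere. So [u] is
   replaced by a copy with time clamped to [0, T] and value 0 off a subset of full measure in
   [Omega]. The bond strains and the factor [G] built from this copy are measurable in the bond and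
   Lipschitz in time without exception, and agree with the originals on almost every bond. Real
   integrals are [fine] parts of extended ones, so an infinite inner integral would silently count
   as 0; this is why finiteness at almost every time matters. It comes from the bound on k (G(0) -
   G(t)), where k is the kernel, over a domain of finite volume. *)
Require Import Defs.
From HB Require Import structures.
From mathcomp Require Import all_boot all_order all_algebra.
From mathcomp Require Import all_classical all_reals all_analysis.
From mathcomp Require Import measurable_realfun ess_sup_inf.
From mathcomp Require Import ring lra.

Set Implicit Arguments.
Unset Strict Implicit.
Unset Printing Implicit Defensive.

Import Order.TTheory GRing.Theory Num.Theory.
Import numFieldNormedType.Exports.

Local Open Scope classical_set_scope.
Local Open Scope ring_scope.

(* The library states these facts for measurable functions; here the integrands
   are only known to be measurable off a null set. *)
Section integral_ae.
Local Open Scope ereal_scope.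
Context d (T : measurableType d) (R : realType).
Variable mu : {measure set T -> \bar R}.
Implicit Types (D : set T) (f g : T -> \bar R).

Import HBNNSimple.

(** The integral of a nonnegative function is a supremum over the simple functions below it. Cutting
    such an [h] off on the exceptional null set puts it below [g] everywhere and keeps its
    integral. *)
Lemma ge0_le_integral_ae D f g : (forall x, D x -> 0 <= f x) ->
  (forall x, D x -> 0 <= g x) -> {ae mu, forall x, D x -> f x <= g x} ->
  \int[mu]_(x in D) f x <= \int[mu]_(x in D) g x.
Proof.
move=> f0 g0 [N [mN N0 subN]]; rewrite !ge0_integralE//.
apply: ge_ereal_sup => _ [h /= hf <-].
have mN' : measurable (~` N) by exact: measurableC.
have hN x : proj_nnsfun h mN' x = (h \_ (~` N)) x by rewrite mrestrict.
apply: ereal_sup_ubound; exists (proj_nnsfun h mN').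
  move=> x; rewrite hN !patchE; case: ifPn => [xN|_]; last first.
    by case: ifPn => // /set_mem /g0.
  apply: (le_trans (hf x)); rewrite patchE.
  case: ifPn => // /set_mem Dx; apply: contrapT => fg.
  by move: xN; rewrite inE; apply; apply: subN => /= /(_ Dx).
have sE (k : {nnsfun T >-> R}) : sintegral mu k = \int[mu]_x (k x)%:E.
  by rewrite integral_nnsfun// patch_setT.
rewrite !sE.
apply: ge0_ae_eq_integral => //.
- exact/measurable_EFinP.
- exact/measurable_EFinP.
- by move=> x _; rewrite lee_fin.
- by move=> x _; rewrite lee_fin.
exists N; split => // x xN; apply: contrapT => Nx; apply: xN => _.
by congr EFin; rewrite hN patchE mem_set.
Qed.

Lemma integral_ae_congr D f g : {ae mu, forall x, D x -> f x = g x} ->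
  \int[mu]_(x in D) f x = \int[mu]_(x in D) g x.
Proof.
have ge0 f' g' : (forall x, D x -> 0 <= f' x) -> (forall x, D x -> 0 <= g' x) ->
    {ae mu, forall x, D x -> f' x = g' x} ->
    \int[mu]_(x in D) f' x = \int[mu]_(x in D) g' x.
  move=> f0 g0 fg; apply/eqP; rewrite eq_le !ge0_le_integral_ae//.
  - by apply: filterS fg => x /[apply] ->.
  - by apply: filterS fg => x /[apply] ->.
move=> /ae_eq_funeposneg[fgp fgn].
by rewrite integralE [RHS]integralE; congr (_ - _); exact: ge0.
Qed.

Lemma Rintegral_ae_congr D (f g : T -> R) :
  {ae mu, forall x, D x -> f x = g x} ->
  (\int[mu]_(x in D) f x = \int[mu]_(x in D) g x)%R.
Proof.
move=> fg; congr fine; apply: integral_ae_congr.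
by apply: filterS fg => x /[apply] ->.
Qed.

(** If the integral is infinite, [fine] turns both sides into 0. A negative [c] reduces to [- c]. *)
Lemma ge0_RintegralZl D (f : T -> R) (c : R) : measurable D ->
  measurable_fun D f -> (forall x, D x -> (0 <= f x)%R) ->
  (\int[mu]_(x in D) (c * f x) = c * \int[mu]_(x in D) f x)%R.
Proof.
move=> mD mf f0; have mEf : measurable_fun D (EFin \o f) by exact/measurable_EFinP.
have H (k : R) : (0 <= k)%R ->
    (\int[mu]_(x in D) (k * f x) = k * \int[mu]_(x in D) f x)%R.
  move=> k0; rewrite /Rintegral; under eq_integral do rewrite EFinM.
  rewrite ge0_integralZl//.
  have := @integral_ge0 _ _ _ mu D (EFin \o f) f0.
  case: (\int[mu]_(x in D) (f x)%:E) => [r|_|] //=.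
  by rewrite mulr0 mulry; have [k1|k1|k1] := sgrP k; rewrite ?mul0e ?mul1e ?mulN1e.
have [c0|c0] := leP 0%R c; first exact: H.
rewrite -[c in LHS]opprK; under eq_Rintegral do rewrite mulNr.
rewrite /Rintegral; under eq_integral do rewrite EFinN.
rewrite integral_ge0N; last first.
  by move=> x Dx; rewrite lee_fin mulr_ge0 ?f0// oppr_ge0 ltW.
have := H (- c)%R; rewrite oppr_ge0 ltW// fineN {1}/Rintegral => -> //.
by rewrite mulNr opprK.
Qed.

End integral_ae.

(** * Joint measurability of paths and of their time derivatives *)

Section caratheodory.
Context d (Z : measurableType d) (R : realType).
Implicit Type f : measurableTypeR R -> Z -> R.

(** Time is rounded down to the grid of mesh 1/(n+1). Preimages under the rounded function are
    countable unions of rectangles, and continuity in time gives convergence to [f]. *)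
Lemma measurable_caratheodory f : (forall t, measurable_fun setT (f t)) ->
  (forall z, continuous (f^~ z)) ->
  measurable_fun setT (fun p : measurableTypeR R * Z => f p.1 p.2).
Proof.
move=> mf cf.
pose step n (t : R) : R := (Num.floor (n.+1%:R * t))%:~R / n.+1%:R.
apply: (@measurable_fun_cvg _ _ _ _ (fun n p => f (step n p.1) p.2)).
  move=> n _ Y mY; rewrite setTI.
  rewrite [X in measurable X](_ : _ = \bigcup_(k : int)
     ([set t : measurableTypeR R | Num.floor (n.+1%:R * t) = k] `*`
      (f (k%:~R / n.+1%:R) @^-1` Y))); last first.
    apply/seteqP; split=> [[t z] /= Yf|[t z] /= [k _ [/= tk]]].
      by exists (Num.floor (n.+1%:R * t)).
    by rewrite /step tk.
  apply: countable_bigcupT_measurable; first exact: countableP.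
  move=> k; apply: measurableX; last by rewrite -[X in measurable X]setTI; exact: mf.
  rewrite (_ : [set t | _] = [set` `[k%:~R / n.+1%:R, (k + 1)%:~R / n.+1%:R[%R]).
    exact: measurable_itv.
  have n0 : (0 : R) < n.+1%:R by [].
  apply/seteqP; split => [t /= <-|t /=]; rewrite in_itv/=.
    rewrite ler_pdivrMr// ltr_pdivlMr// mulrC.
    by rewrite floor_le /= floorD1_gt.
  rewrite ler_pdivrMr// ltr_pdivlMr// mulrC => /andP[k1 k2].
  by apply/floor_def; rewrite k1.
move=> [t z] _ /=; apply: (cvg_comp (fun n => step n t) (f^~ z)); last exact: cf.
apply/cvgrPdist_lt => e e0.
near=> n; have n0 : (0 : R) < n.+1%:R by [].
have -> : t = (n.+1%:R * t) / n.+1%:R by rewrite mulrC mulKf ?gt_eqF.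
rewrite /step [X in Num.floor (_ * X)](_ : _ = t); last first.
  by rewrite mulrC mulKf ?gt_eqF.
rewrite -mulrBl ger0_norm; last first.
  by rewrite divr_ge0// subr_ge0 floor_le.
rewrite ltr_pdivrMr//; apply: (@lt_trans _ _ 1).
  by rewrite ltrBlDr addrC -[1](_ : 1%:~R = _)// -intrD floorD1_gt.
by rewrite -ltr_pdivrMr// div1r; near: n; exact: (near_infty_natSinv_lt (PosNum e0)).
Unshelve. all: by end_near. Qed.

End caratheodory.

Section measurable_derive1.
Context d (Z : measurableType d) (R : realType).

(* Only rational increments: this makes derivability of a continuous path a
   countable, hence measurable, condition. *)
Definition rat_cauchy0 (phi : R -> R) := forall n : nat, exists m : nat,
  forall a b : rat, a != 0 -> b != 0 -> `|ratr a : R| < m.+1%:R^-1 ->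
  `|ratr b : R| < m.+1%:R^-1 -> `|phi (ratr a) - phi (ratr b)| <= n.+1%:R^-1.

(** By continuity off 0, a strict failure of the Cauchy bound at a real increment persists on an
    open set, which contains a rational. *)
Lemma cvg_dnbhs0_rat_cauchy (phi : R -> R) :
  (forall h, h != 0 -> {for h, continuous phi}) ->
  cvg (phi @ 0^') <-> rat_cauchy0 phi.
Proof.
move=> cphi; split => [/cvg_ex[l /= phil] n|H].
  have e0 : 0 < (n.+1%:R : R)^-1 / 2 by rewrite divr_gt0.
  move/cvgrPdist_lt : phil => /(_ _ e0)[dl /= dl0 dlP].
  have [m _ mP] := near_infty_natSinv_lt (PosNum dl0).
  exists m => a b a0 b0 am bm.
  have phi_lt (c : rat) : c != 0 -> `|ratr c : R| < m.+1%:R^-1 ->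
      `|l - phi (ratr c)| < (n.+1%:R : R)^-1 / 2.
    move=> c0 cm; apply: dlP; last by rewrite fmorph_eq0.
    by rewrite /= sub0r normrN; exact: lt_trans cm (mP m (leqnn m)).
  rewrite -(subrK l (phi (ratr a))) -addrA (le_trans (ler_normD _ _))//.
  rewrite [leRHS]splitr lerD// ltW// ?phi_lt//.
  by rewrite distrC phi_lt.
apply/cauchy_cvgP/cauchy_exP => e e0.
have [n _ nP] := near_infty_natSinv_lt (PosNum e0).
have {nP}ne := nP n (leqnn n).
(* [m.+2] puts [b] strictly inside the radius given by [m]. *)
have [m mP] := H n; pose b : rat := m.+2%:R^-1.
have b0 : b != 0 by rewrite invr_eq0 pnatr_eq0.
have bm : `|ratr b : R| < m.+1%:R^-1.
  rewrite /b fmorphV /= ratr_nat ger0_norm ?invr_ge0// ltf_pV2 ?posrE//.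
  by rewrite ltr_nat.
exists (phi (ratr b)).
exists m.+1%:R^-1 => /=; first by rewrite invr_gt0.
move=> h /=; rewrite sub0r normrN => hm h0; rewrite /ball/=.
apply: le_lt_trans ne; rewrite leNgt; apply/negP => bh.
have : nbhs h [set x | [/\ x != 0, `|x| < m.+1%:R^-1 &
    n.+1%:R^-1 < `|phi (ratr b) - phi x| ]].
  have c1 : {for h, continuous (fun x => `|phi (ratr b) - phi x|)}.
    apply: cvg_norm; apply: cvgB; first exact: cvg_cst.
    exact: cphi.
  have c2 : {for h, continuous (fun x : R => `|x|)} by exact: norm_continuous.
  apply: filterS3 (cvgr_neq0 h (@cvg_id _ (nbhs h)) h0) (cvgr_lt _ c2 _ hm)
    (cvgr_gt _ c1 _ bh) => x x0 xm xb.
  by split.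
rewrite nbhsE => -[U [oU Uh] UP].
have [x [/UP[x0 xm xb] [a _ xE]]] := @dense_rat R U (ex_intro _ h Uh) oU.
move: xb; rewrite -xE ltNge distrC mP//; last by rewrite xE.
by move: x0; rewrite -xE fmorph_eq0.
Unshelve. all: by end_near. Qed.

(** The set [G] where the difference quotient converges is obtained by countable operations; on it
    the derivative is the limit along the increments 1/(n+1). *)
Lemma measurable_derive1 (f : measurableTypeR R -> Z -> R) :
  (forall t, measurable_fun setT (f t)) -> (forall z, continuous (f^~ z)) ->
  measurable_fun setT (fun p : measurableTypeR R * Z => derive1 (f^~ p.2) p.1).
Proof.
move=> mf cf.
pose q (h : R) (p : measurableTypeR R * Z) := h^-1 * (f (h + p.1) p.2 - f p.1 p.2).
have cfh h z : continuous (fun t : R => f (h + t) z).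
  move=> t; apply: (cvg_comp (fun t => h + t) (f^~ z)); last exact: cf.
  by apply: cvgD; [exact: cvg_cst|exact: cvg_id].
have mq h : measurable_fun setT (q h).
  apply: measurable_funM => //; apply: measurable_funB.
    by apply: (measurable_caratheodory (f := fun t z => f (h + t) z)) => // t; exact: mf.
  exact: measurable_caratheodory.
pose C (a b : rat) (m : nat) := [&& a != 0, b != 0, `|ratr a : R| < m.+1%:R^-1 &
  `|ratr b : R| < m.+1%:R^-1].
pose B n m (ab : rat * rat) := [set p | C ab.1 ab.2 m /\
  n.+1%:R^-1 < `|q (ratr ab.1) p - q (ratr ab.2) p|].
pose G := ~` \bigcup_n \bigcap_m \bigcup_ab B n m ab.
have mG : measurable G.
  apply: measurableC; apply: bigcup_measurable => n _.
  apply: bigcapT_measurable => m.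
  apply: countable_bigcupT_measurable; first exact: countableP.
  move=> [a b]; rewrite /B/=; have [Cab|NCab] := boolP (C a b m); last first.
    rewrite (_ : [set _ | _] = set0)//.
    by apply/seteqP; split => // p [].
  rewrite (_ : [set _ | _] = [set p | n.+1%:R^-1 < `|q (ratr a) p - q (ratr b) p|]).
    rewrite -[X in measurable X]setTI.
    apply: (measurable_fun_ltr (measurable_cst _)) => //.
    by apply: measurableT_comp => //; exact: measurable_funB.
  by apply/seteqP; split => p //= [].
have GE p : G p <-> cvg (q^~ p @ 0^').
  rewrite cvg_dnbhs0_rat_cauchy; last first.
    move=> h h0; apply: cvgM; first exact: inv_continuous.
    apply: cvgB; last exact: cvg_cst.
    by apply: (cvg_comp (fun h => h + p.1) (f^~ p.2)); [|exact: cf];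
      apply: cvgD; [exact: cvg_id|exact: cvg_cst].
  split=> [Gp n|H [n _ nP]].
    apply: contrapT => /forallNP Hn; apply: Gp; exists n => // m _.
    apply: contrapT => Bm; apply: (Hn m) => a b a0 b0 am bm.
    rewrite leNgt; apply/negP => ab; apply: Bm; exists (a, b) => //.
    by split => //; apply/and4P.
  have [m mP] := H n; have [[a b] _ [/= /and4P[a0 b0 am bm]]] := nP m I.
  by rewrite ltNge mP.
(* Off [G] the derivative is [point], the value of [lim] on a divergent filter. *)
apply: (measurable_fun_cvg (h := fun (n : nat) p =>
  if p \in G then q (n.+1%:R^-1) p else (point : R))).
  move=> n; apply: measurable_fun_ifT => //.
  apply: (measurable_fun_bool true); rewrite setTI (_ : _ @^-1` _ = G)//.
  by apply/seteqP; split => p /=; [move/set_mem|move/mem_set].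
move=> p _; have [/set_mem/GE pG|pG] := boolP (p \in G).
  by move/cvgr_dnbhsP : pG; apply; split => [n|]; [exact/invr_neq0|exact: cvg_harmonic].
rewrite /derive1 dvgP; first exact: cvg_cst.
by move/GE => Gp; move: pG; rewrite mem_set.
Qed.

End measurable_derive1.

(** * Fundamental theorem of calculus for nondecreasing Lipschitz functions *)

Lemma lebesgue_stieltjes_measure_oc {R : realType} (f : cumulative R R) a b :
  a <= b -> lebesgue_stieltjes_measure f `]a, b] = (f b - f a)%:E.
Proof.
move=> ab; rewrite /lebesgue_stieltjes_measure /measure_extension.
by rewrite measurable_mu_extE/= ?wlength_itv_bnd//; exact: is_ocitv.
Qed.

Lemma lipschitz_continuous {R : realType} (r : R -> R) (L : R) : 0 <= L ->
  (forall s t, `|r t - r s| <= L * `|t - s|) -> continuous r.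
Proof.
move=> L0 lipr t; apply/cvgrPdist_lt => e e0.
have L1 : 0 < L + 1 by rewrite ltr_wpDl.
exists (e / (L + 1)) => /=; first by rewrite divr_gt0.
move=> s; rewrite /ball/= ltr_pdivlMr// mulrC; apply: le_lt_trans.
by rewrite (le_trans (lipr _ _))// ler_wpM2r// lerDl.
Qed.

Section lipschitz_FTC.
Context {R : realType}.
Local Notation mu := (@lebesgue_measure R).
Variables (F : R -> R) (K : R).
Hypothesis ndF : {homo F : x y / x <= y}.
Hypothesis lipF : forall x y, x <= y -> F y - F x <= K * (y - x).

Let K0 : 0 <= K.
Proof.
have := lipF (@ler01 R); rewrite subr0 mulr1; apply: le_trans.
by rewrite subr_ge0 ndF.
Qed.

Let cF : continuous F.
Proof.
apply: (lipschitz_continuous K0) => s t.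
wlog st : s t / s <= t.
  by move=> H; have [/H//|/ltW/H] := leP s t; rewrite distrC [X in _ * X]distrC.
by rewrite !ger0_norm ?subr_ge0 ?ndF// lipF.
Qed.

(** The complement of [F] in a line steeper than [F]: it is nondecreasing and so has its own
    Stieltjes measure. The added 1 keeps the slope positive when [K] is 0. *)
Let G x := (K + 1) * x - F x.

Let ndG : {homo G : x y / x <= y}.
Proof.
move=> x y xy; rewrite /G lerBrDr addrAC -lerBrDr opprK.
have := lipF xy; rewrite mulrBr !mulrDl !mul1r; lra.
Qed.

Let cG : continuous G.
Proof.
by move=> x; apply: cvgB; [apply: cvgM; [exact: cvg_cst|exact: cvg_id]|exact: cF].
Qed.

Let CF : cumulative R R := HB.pack F
  (isCumulative.Build _ _ _ F ndF (right_continuousW cF)).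
Let CG : cumulative R R := HB.pack G
  (isCumulative.Build _ _ _ G ndG (right_continuousW cG)).
Let muF := lebesgue_stieltjes_measure CF.
Let muG := lebesgue_stieltjes_measure CG.

Let K1_ge0 : 0 <= (K + 1)^-1. Proof. by rewrite invr_ge0 addr_ge0. Qed.

(** The Stieltjes measures of [F] and [G] add up to [K + 1] times Lebesgue measure, by uniqueness on
    half-open intervals. Both terms are nonnegative, so a Lebesgue-null set is null for [muF]. *)
Let muF_dominated : muF `<< mu.
Proof.
pose nu := mscale (NngNum K1_ge0) (measure_add muF muG).
have nuE A : nu A = (((K + 1)^-1)%:E * (muF A + muG A))%E.
  by rewrite -(measure_addE muF muG).
suff muE A : measurable A -> mu A = nu A.
  apply/null_content_dominatesP => A mA muA0.
  have /eqP := etrans (esym (muE A mA)) muA0.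
  rewrite nuE mule_eq0 eqe invr_eq0 gt_eqF/= ?ltr_wpDl//.
  by rewrite padde_eq0// => /andP[/eqP].
move: A; apply: lebesgue_measure_unique.
have nuX (X : set (measurableTypeR R)) p q : muF X = p -> muG X = q ->
    nu X = (((K + 1)^-1)%:E * (p + q))%E.
  by rewrite nuE => -> ->.
move=> _ [[a b] _ <-] /=; have [ab|ba] := leP a b; last first.
  have Z (m : {measure set (measurableTypeR R) -> \bar R}) : m `]a, b]%classic = 0%E.
    by rewrite set_itv_ge ?measure0// bnd_simp -leNgt ltW.
  apply: etrans (esym (nuX _ _ _ (Z muF) (Z muG))).
  by rewrite adde0 mule0; exact: Z.
have oc f := lebesgue_stieltjes_measure_oc f ab.
apply: etrans (esym (nuX _ _ _ (oc CF) (oc CG))); apply: etrans (oc idfun) _.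
rewrite -EFinD -EFinM; congr EFin => /=.
rewrite /G [X in _ * X](_ : _ = (K + 1) * (b - a)); last by ring.
by rewrite mulKf// gt_eqF// ltr_wpDl.
Qed.

(** The density [fR] of [muF] has indefinite integral F - F(a); Lebesgue differentiation then
    identifies [fR] with the derivative of [F] almost everywhere. *)
Lemma lipschitz_FTC a b : a <= b ->
  (\int[mu]_(x in `[a, b]) (derive1 F x)%:E = (F b - F a)%:E)%E.
Proof.
(* Room to the right of [b]: the integral formula for [F] has to hold on a neighbourhood of each x
   <= b, including [b]. *)
move=> ab; pose c := b + 1; have ac : a <= c by rewrite (le_trans ab)// lerDl.
have mD : measurable (`]a, c] : set (measurableTypeR R)) by exact: measurable_itv.
have Doo : (muF `]a, c] < +oo)%E.
  by rewrite /muF lebesgue_stieltjes_measure_oc// ltry.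
pose nu : {finite_measure set (measurableTypeR R) -> \bar R} := mfrestr mD Doo.
have numu : nu `<< mu.
  apply/null_content_dominatesP => A mA muA0.
  have /null_content_dominatesP/(_ A mA muA0) muFA := muF_dominated.
  apply: (subset_measure0 _ _ _ muFA) => //; exact: measurableI.
pose f := Radon_Nikodym_SigmaFinite.f nu mu.
pose fR := fine \o f.
have fE x : (fR x)%:E = f x by rewrite fineK// Radon_Nikodym_SigmaFinite.f_fin_num.
have intf : mu.-integrable setT (EFin \o fR).
  have := Radon_Nikodym_SigmaFinite.f_integrable numu.
  by apply: eq_integrable => // x _ /=; rewrite fE.
have nuE x : a <= x -> x <= c -> (\int[mu]_(y in `]a, x]) (fR y)%:E = (F x - F a)%:E)%E.
  move=> ax xc; under eq_integral do rewrite fE.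
  rewrite -(Radon_Nikodym_SigmaFinite.f_integral numu)//.
  rewrite /nu /= /mfrestr /mrestr setIidl; last first.
    by apply: subset_itvl; rewrite bnd_simp.
  by rewrite /muF lebesgue_stieltjes_measure_oc.
have mfR A : measurable A -> measurable_fun A (EFin \o fR).
  by move=> mA; have /measurable_int := intf; exact: measurable_funS.
transitivity (\int[mu]_(x in `[a, b]) (fR x)%:E)%E; last first.
  rewrite -integral_itv_obnd_cbnd; last first.
    by apply: mfR; exact: measurable_itv.
  by rewrite nuE// lerDl.
have FTC := @FTC1 R fR (BRight a).
have {FTC} /= FTC : {ae mu, forall x, (BRight a < BRight x)%O ->
    derivable (fun x => \int[mu]_(t in `]a, x]) fR t) x 1 /\
    derive1 (fun x => \int[mu]_(t in `]a, x]) fR t) x = fR x}.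
  apply: FTC; last by apply: open_integrable_locally; [exact: openT|exact: intf].
  by move=> y; apply: integrableS intf => //; exact: measurable_itv.
(* The differentiation theorem only speaks of points strictly to the right of [a]. *)
have ae_a : {ae mu, forall x, x != a}.
  exists [set a]; split => //; first by rewrite lebesgue_measure_set1.
  by move=> x /= /negP; rewrite negbK => /eqP.
apply: integral_ae_congr; move: FTC ae_a; apply: filterS2.
  exact: (ae_filter_ringOfSetsType mu).
move=> x FTCx xa.
rewrite /= in_itv/= => /andP[ax xb]; congr EFin.
have {}ax : a < x by rewrite lt_neqAle eq_sym xa.
have [//|dI <-] := FTCx.
set I := (fun y => _) in dI *.
have FE : \near x, F x = (cst (F a) + I) x.
  have xc : x < c by rewrite (le_lt_trans xb)// ltrDl.
  have : \near x, x \in `]a, c[ by apply: near_in_itvoo; rewrite in_itv/= ax.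
  apply: filterS => y; rewrite in_itv/= => /andP[ay yc].
  have -> : (cst (F a) + I) y = F a + (F y - F a).
    by congr (F a + _); apply: (congr1 fine (nuE _ (ltW ay) (ltW yc))).
  by rewrite addrC subrK.
rewrite derive1E [RHS]derive1E (near_eq_derive _ FE).
rewrite deriveD; [|exact: derivable_cst|exact: dI].
by rewrite derive_cst add0r.
Qed.

End lipschitz_FTC.

(** * Tonelli on subdomains, then for real-valued iterated integrals *)

Section tonelli_domains.
Local Open Scope ereal_scope.
Context d1 d2 (T1 : measurableType d1) (T2 : measurableType d2) (R : realType).
Variables (m1 : {sigma_finite_measure set T1 -> \bar R})
  (m2 : {sigma_finite_measure set T2 -> \bar R}).
Variables (D1 : set T1) (D2 : set T2).
Hypotheses (mD1 : measurable D1) (mD2 : measurable D2).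
Variable f : T1 * T2 -> \bar R.
Hypotheses (mf : measurable_fun setT f) (f0 : forall p, 0 <= f p).

Let mpatch (A : set T1) (B : set T2) : measurable A -> measurable B ->
  measurable_fun setT (f \_ (A `*` B)).
Proof.
move=> mA mB; apply/(measurable_restrictT _ (measurableX mA mB)).
exact: measurable_funS mf.
Qed.

Lemma measurable_fun_integral_dom :
  measurable_fun setT (fun x => \int[m2]_(y in D2) f (x, y)).
Proof.
have := @measurable_fun_fubini_tonelli_F _ _ _ _ _ m2 _
  (mpatch (@measurableT _ T1) mD2).
rewrite /fubini_F => H.
rewrite (_ : (fun x => _) = fun x => \int[m2]_y (f \_ (setT `*` D2)) (x, y)).
  by apply: H => p; rewrite patchE; case: ifP.
apply/funext => x; rewrite integral_mkcond; apply: eq_integral => y _.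
rewrite !patchE; congr (if _ then _ else _).
by apply/idP/idP; rewrite !inE => // -[].
Qed.

(** Fubini-Tonelli for the extension of [f] by 0 off the product of the domains. *)
Lemma tonelli_dom : \int[m1]_(x in D1) \int[m2]_(y in D2) f (x, y) =
  \int[m2]_(y in D2) \int[m1]_(x in D1) f (x, y).
Proof.
have g0 p : 0 <= (f \_ (D1 `*` D2)) p by rewrite patchE; case: ifP.
have := @fubini_tonelli _ _ _ _ _ m1 m2 _ (mpatch mD1 mD2) g0.
set L := LHS; set L' := (X in X = _ -> _) => H.
transitivity L'; last rewrite H.
  rewrite /L integral_mkcond; apply: eq_integral => x _; rewrite patchE.
  case: ifPn => [xD1|xD1].
    rewrite integral_mkcond; apply: eq_integral => y _; rewrite !patchE.
    congr (if _ then _ else _); apply/idP/idP => [/set_mem yD2|/set_mem[_ /mem_set]//].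
    by apply/mem_set; split => //; exact: set_mem.
  rewrite (eq_integral (cst 0)) ?integral0// => y _; rewrite patchE.
  by case: ifPn => //; rewrite inE => -[/= /mem_set]; rewrite (negbTE xD1).
rewrite [RHS]integral_mkcond; apply: eq_integral => y _; rewrite patchE.
case: ifPn => [yD2|yD2].
  rewrite [RHS]integral_mkcond; apply: eq_integral => x _; rewrite !patchE.
  congr (if _ then _ else _); apply/idP/idP => [/set_mem[/mem_set]//|/set_mem xD1].
  by apply/mem_set; split => //; exact: set_mem.
rewrite (eq_integral (cst 0)) ?integral0// => x _; rewrite patchE.
by case: ifPn => //; rewrite inE => -[/= _ /mem_set]; rewrite (negbTE yD2).
Qed.

End tonelli_domains.

Section Rintegral_iterated.
Local Open Scope ereal_scope.
Context d1 (T1 : measurableType d1) (R : realType).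
Variables (m1 : {measure set T1 -> \bar R}) (D1 : set T1).
Hypothesis mD1 : measurable D1.

(** A finite integral makes [f] finite almost everywhere, where [fine] loses nothing. *)
Lemma integral_fine (f : T1 -> \bar R) : measurable_fun setT f ->
  (forall x, 0 <= f x) -> \int[m1]_(x in D1) f x < +oo ->
  \int[m1]_(x in D1) (fine (f x))%:E = \int[m1]_(x in D1) f x.
Proof.
move=> mf f0 foo; apply: integral_ae_congr.
have : m1.-integrable D1 f.
  apply/integrableP; split; first exact: measurable_funS mf.
  by under eq_integral do rewrite gee0_abs//.
move/integrable_ae => /(_ mD1); apply: filterS => x /[apply].
exact: fineK.
Qed.

End Rintegral_iterated.

Section Rtonelli3.
Context d1 d2 d3 (T1 : measurableType d1) (T2 : measurableType d2)
  (T3 : measurableType d3) (R : realType).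
Variables (m1 : {sigma_finite_measure set T1 -> \bar R})
  (m2 : {sigma_finite_measure set T2 -> \bar R})
  (m3 : {sigma_finite_measure set T3 -> \bar R}).
Variables (D1 : set T1) (D2 : set T2) (D3 : set T3).
Hypotheses (mD1 : measurable D1) (mD2 : measurable D2) (mD3 : measurable D3).
Variable f : T1 * (T2 * T3) -> R.
Hypotheses (mf : measurable_fun setT f) (f0 : forall p, 0 <= f p).

Let I23 x := (\int[m2]_(y in D2) \int[m3]_(z in D3) (f (x, (y, z)))%:E)%E.

Let mI3 : measurable_fun setT
  (fun p : T1 * T2 => \int[m3]_(z in D3) (f (p.1, (p.2, z)))%:E)%E.
Proof.
apply: (@measurable_fun_integral_dom _ _ _ _ _ m3 _ mD3
  (fun p : (T1 * T2) * T3 => (f (p.1.1, (p.1.2, p.2)))%:E)).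
  apply/measurable_EFinP; apply: (measurableT_comp mf).
  apply: measurable_fun_pair; first exact: measurableT_comp measurable_fst.
  apply: measurable_fun_pair; last exact: measurable_snd.
  exact: measurableT_comp measurable_fst.
by move=> p; rewrite lee_fin.
Qed.

Let mI23 : measurable_fun setT I23.
Proof.
apply: (@measurable_fun_integral_dom _ _ _ _ _ m2 _ mD2
  (fun p : T1 * T2 => \int[m3]_(z in D3) (f (p.1, (p.2, z)))%:E)%E) => //.
by move=> p; apply: integral_ge0 => z _; rewrite lee_fin.
Qed.

(** Two exchanges: the outer variable passes the second one, then, for fixed y, the third. *)
Lemma integral3_rotate :
  (\int[m1]_(x in D1) I23 x =
   \int[m2]_(y in D2) \int[m3]_(z in D3) \int[m1]_(x in D1) (f (x, (y, z)))%:E)%E.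
Proof.
rewrite /I23 (@tonelli_dom _ _ _ _ _ m1 m2 _ _ mD1 mD2
  (fun p : T1 * T2 => \int[m3]_(z in D3) (f (p.1, (p.2, z)))%:E)%E)//; last first.
  by move=> p; apply: integral_ge0 => z _; rewrite lee_fin.
apply: eq_integral => y _.
apply: (@tonelli_dom _ _ _ _ _ m1 m3 _ _ mD1 mD3
  (fun p : T1 * T3 => (f (p.1, (y, p.2)))%:E)) => [|p]; last by rewrite lee_fin.
apply/measurable_EFinP; apply: (measurableT_comp mf).
apply: measurable_fun_pair; first exact: measurable_fst.
by apply: measurable_fun_pair; [exact: measurable_cst|exact: measurable_snd].
Qed.

(** By Tonelli the finite rotated integral is also the original one, so the inner double integral is
    finite for almost every x; for such x the inner applications of [fine] are harmless. *)
Lemma Rintegral3_rotate :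
  (\int[m2]_(y in D2) \int[m3]_(z in D3) \int[m1]_(x in D1) (f (x, (y, z)))%:E
     < +oo)%E ->
  \int[m1]_(x in D1) \int[m2]_(y in D2) \int[m3]_(z in D3) f (x, (y, z)) =
  fine (\int[m2]_(y in D2) \int[m3]_(z in D3) \int[m1]_(x in D1)
    (f (x, (y, z)))%:E)%E.
Proof.
rewrite -integral3_rotate => foo; congr fine.
have I23_ge0 x : (0 <= I23 x)%E.
  by do 2 (apply: integral_ge0 => ? _); rewrite lee_fin.
apply: etrans (integral_fine mD1 mI23 I23_ge0 foo); apply: integral_ae_congr.
have : m1.-integrable D1 I23.
  apply/integrableP; split; first exact: measurable_funS mI23.
  by under eq_integral do rewrite gee0_abs//.
move/integrable_ae => /(_ mD1); apply: filterS => x /[apply].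
rewrite ge0_fin_numE// => I23x; congr EFin; congr fine.
have mI3x : measurable_fun setT (fun y => \int[m3]_(z in D3) (f (x, (y, z)))%:E)%E.
  apply: (measurableT_comp mI3 (f := fun p : T1 * T2 => _) (g := fun y => (x, y))).
  by apply: measurable_fun_pair; [exact: measurable_cst|exact: measurable_id].
by rewrite -[RHS]integral_fine// => y; apply: integral_ge0 => z _; rewrite lee_fin.
Qed.

End Rtonelli3.

(** * Measurability and volume in R^n *)

Section measurable_rV.
Context {R : realType}.

(** An open set is the union of the countably many rational cubes that it contains. *)
Lemma open_measurable_rV n (U : set 'rV[R]_n) : open U -> measurable U.
Proof.
move=> oU.
pose box (c : 'rV[rat]_n * rat) : set 'rV[R]_n := [set x | forall i,
  `|x ord0 i - ratr (c.1 ord0 i)| < ratr c.2].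
rewrite (_ : U = \bigcup_c (if `[< box c `<=` U >] then box c else set0)).
  apply: countable_bigcupT_measurable; first exact: countableP.
  move=> c; case: asboolP => // _.
  rewrite (_ : box c = \bigcap_(i in [set: 'I_n]) (rV_coord i @^-1`
      [set t : measurableTypeR R | `|t - ratr (c.1 ord0 i)| < ratr c.2])); last first.
    by apply/seteqP; split => [x H i _|x H i]; [exact: H|exact: (H i)].
  apply: fin_bigcap_measurable => // i _.
  rewrite -[X in measurable X]setTI; apply: measurable_rV_coord => //.
  rewrite (_ : [set t | _] = ball (ratr (c.1 ord0 i) : R) (ratr c.2)).
    exact: measurable_ball.
  by apply/seteqP; split => t /=; rewrite /ball/= distrC.
apply/seteqP; split => [x Ux|x [c _]]; last by case: asboolP => // + ?; exact.
have /nbhs_ballP[e /= e0 xeU] : nbhs x U by exact: open_nbhs_nbhs.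
(* With half-width [r] below e/2, a cube centred within [r] of [x] contains [x] and stays in the
   ball of radius [e]. *)
have [r] := rat_in_itvoo (divr_gt0 e0 (ltr0Sn R 1)).
rewrite in_itv/= => /andP[r0 re].
have qP i : exists q : rat, `|x ord0 i - ratr q| < (ratr r : R).
  have [|q] := @rat_in_itvoo R (x ord0 i - ratr r) (x ord0 i + ratr r).
    by rewrite ltrBlDr -addrA ltrDl addr_gt0.
  rewrite in_itv/= => /andP[q1 q2]; exists q.
  by rewrite ltr_norml; apply/andP; split; lra.
pose q : 'rV[rat]_n := \row_i sval (cid (qP i)).
have qx i : `|x ord0 i - ratr (q ord0 i)| < ratr r.
  by rewrite mxE; case: cid.
exists (q, r) => //; case: asboolP => // -[].
move=> y yq; apply: xeU; split => // i j; rewrite (ord1 i).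
rewrite /ball/= (splitr e).
rewrite (le_lt_trans (ler_distD (ratr (q ord0 j)) _ _))// ltrD//.
  exact: lt_trans (qx j) _.
by rewrite distrC (lt_trans (yq j)).
Qed.

Lemma measurable_dotp d (T : measurableType d) n (f g : T -> 'rV[R]_n) :
  measurable_fun setT f -> measurable_fun setT g ->
  measurable_fun setT (fun x => dotp (f x) (g x)).
Proof.
move=> /measurable_fun_rVP mf /measurable_fun_rVP mg.
apply: measurable_sum => i; apply: measurable_funM; [exact: mf|exact: mg].
Qed.

Lemma measurable_rVB d (T : measurableType d) n (f g : T -> 'rV[R]_n) :
  measurable_fun setT f -> measurable_fun setT g ->
  measurable_fun setT (fun x => f x - g x).
Proof.
move=> /measurable_fun_rVP mf /measurable_fun_rVP mg; apply/measurable_fun_rVP => i.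
rewrite (_ : _ \o _ = (rV_coord i \o f) \- (rV_coord i \o g)).
  by apply: measurable_funB; [exact: mf|exact: mg].
by apply/funext => x; rewrite /= /rV_coord !mxE.
Qed.

Lemma measurable_rVZ d (T : measurableType d) n (a : T -> R) (f : T -> 'rV[R]_n) :
  measurable_fun setT a -> measurable_fun setT f ->
  measurable_fun setT (fun x => a x *: f x).
Proof.
move=> ma /measurable_fun_rVP mf; apply/measurable_fun_rVP => i.
rewrite (_ : _ \o _ = a \* (rV_coord i \o f)); first by apply: measurable_funM; last exact: mf.
by apply/funext => x; rewrite /= /rV_coord !mxE.
Qed.

Lemma measurable_sqrt : measurable_fun setT (@Num.sqrt R).
Proof. by apply: continuous_measurable_fun; exact: sqrt_continuous. Qed.

Lemma measurable_enorm d (T : measurableType d) n (f : T -> 'rV[R]_n) :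
  measurable_fun setT f -> measurable_fun setT (fun x => enorm (f x)).
Proof.
by move=> mf; exact: measurableT_comp measurable_sqrt (measurable_dotp mf mf).
Qed.

Lemma enorm_ge0 n (v : 'rV[R]_n) : 0 <= enorm v.
Proof. exact: sqrtr_ge0. Qed.

(** Inversion is discontinuous at 0, hence the detour through a real power, which agrees with it on
    nonnegative numbers, 0 included. *)
Lemma measurable_enormV d (T : measurableType d) n (f : T -> 'rV[R]_n) :
  measurable_fun setT f -> measurable_fun setT (fun x => (enorm (f x))^-1).
Proof.
move=> mf; rewrite (_ : (fun x => _) = fun x => enorm (f x) `^ (-1)).
  exact: measurableT_comp (@measurable_powR R (-1)) (measurable_enorm mf).
by apply/funext => x; rewrite powR_inv1// enorm_ge0.
Qed.

Lemma measurable_scaled_strain d (T : measurableType d) n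
    (x y : T -> 'rV[R]_n) (w : 'rV[R]_n -> 'rV[R]_n) :
  measurable_fun setT x -> measurable_fun setT y -> measurable_fun setT w ->
  measurable_fun setT (fun p => scaled_strain (y p) (x p) w).
Proof.
move=> mx my mw; have mB := measurable_rVB my mx.
apply: measurable_funM.
  exact: measurableT_comp measurable_sqrt (measurable_enorm mB).
have mV := measurable_enormV mB.
apply: measurable_dotp; apply: measurable_rVZ => //.
by apply: measurable_rVB; exact: measurableT_comp.
Qed.

Lemma norm_coord_le n (v : 'rV[R]_n) i : `|v ord0 i| <= `|v|.
Proof.
by rewrite [leRHS]mx_normrE; exact: (le_bigmax _ (fun ij => `|v ij.1 ij.2|) (ord0, i)).
Qed.

Lemma bounded_lebesgue_rV n (A : set 'rV[R]_n) : measurable A ->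
  bounded_set A -> (lebesgue_rV n A < +oo)%E.
Proof.
move=> mA [M [_ AM]].
(* Boundedness is available for every bound strictly above [M], and a box needs a nonnegative
   half-width. *)
pose m := `|M| + 1.
have m0 : 0 <= m by rewrite addr_ge0.
pose a : 'rV[R]_n := const_mx (- m); pose b : 'rV[R]_n := const_mx m.
have ab i : a ord0 i <= b ord0 i by rewrite !mxE lerNl (le_trans _ m0)// oppr_le0.
have := lebesgue_rV_box ab.
set B := [set x | _] => BE.
apply: (@le_lt_trans _ _ (lebesgue_rV n B)); last by rewrite BE ltry.
apply: le_measure; rewrite ?inE//.
  rewrite (_ : B = \bigcap_(i in [set: 'I_n]) (rV_coord i @^-1`
      [set` `[a ord0 i, b ord0 i]])); last first.
    by apply/seteqP; split => [x H i _|x H i]; [exact: H|exact: (H i)].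
  apply: fin_bigcap_measurable => // i _.
  by rewrite -[X in measurable X]setTI; exact: measurable_rV_coord.
move=> x Ax i; rewrite !mxE in_itv/= -ler_norml.
have Mm : M < m by rewrite /m (le_lt_trans (ler_norm M))// ltrDl.
exact: le_trans (norm_coord_le x i) (AM m Mm x Ax).
Qed.

End measurable_rV.

(** * The nonlocal kernel: sign, bound, support and measurability *)

Section kernel.
Context {R : realType} {d : nat}.
Variables (Omega : set 'rV[R]_d) (J : R -> R) (eps M : R).
Hypotheses (mO : measurable Omega) (hJ : influence_function J M) (eps0 : 0 < eps).

Lemma nonlocal_kernel_ge0 y x : 0 <= nonlocal_kernel Omega J eps y x.
Proof.
have [J0 _ _ _ _] := hJ.
rewrite /nonlocal_kernel divr_ge0// ?mulr_ge0//.
- by rewrite J0// divr_ge0// ?enorm_ge0// ltW.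
- exact: ltW.
- exact/fine_ge0/measure_ge0.
- by rewrite exprn_ge0// ltW.
Qed.

Lemma nonlocal_kernel_le y x : nonlocal_kernel Omega J eps y x <=
  M / (eps * (unit_ball_volume (R := R) (d := d) * eps ^+ d)).
Proof.
have [J0 ndJ _ JM _] := hJ.
rewrite /nonlocal_kernel ler_wpM2r//.
  rewrite invr_ge0 ?mulr_ge0//; first exact: ltW.
    exact/fine_ge0/measure_ge0.
  by rewrite exprn_ge0// ltW.
have e0 : 0 <= enorm (y - x) / eps by rewrite divr_ge0 ?enorm_ge0// ltW.
rewrite -JM -[leRHS]mul1r ler_pM ?J0 ?ndJ// indicE lern1 leq_b1.
Qed.

Lemma nonlocal_kernel_far y x : eps <= enorm (y - x) ->
  nonlocal_kernel Omega J eps y x = 0.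
Proof.
have [_ _ _ _ J1] := hJ; move=> exy.
by rewrite /nonlocal_kernel J1 ?mulr0 ?mul0r// ler_pdivlMr// mul1r.
Qed.

Lemma measurable_nonlocal_kernel :
  measurable_fun setT (fun p : 'rV[R]_d * 'rV[R]_d => nonlocal_kernel Omega J eps p.2 p.1).
Proof.
have [J0 ndJ _ _ _] := hJ.
apply: measurable_funM => //; apply: measurable_funM.
  have m1 : measurable_fun setT (\1_Omega : _ -> R) by exact: measurable_indic.
  exact: (measurableT_comp m1 measurable_snd).
(* [J] is monotone on nonnegative arguments only; precomposed with the maximum with 0 it is monotone
   on the whole line. *)
rewrite (_ : (fun p => _) = (fun z => J (Num.max z 0)) \o
    (fun p : 'rV[R]_d * 'rV[R]_d => enorm (p.2 - p.1) / eps)).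
  apply: measurableT_comp.
    apply: nonincreasing_measurable => // z z' zz'.
    by apply: ndJ; [rewrite le_max lexx orbT|rewrite ge_max !le_max zz' lexx !orbT].
  apply: measurable_funM => //; apply: measurable_enorm.
  by apply: measurable_rVB; [exact: measurable_snd|exact: measurable_fst].
apply/funext => p /=; congr J; apply/esym/max_idPl.
by rewrite divr_ge0 ?enorm_ge0// ltW.
Qed.

End kernel.

(** * Real induction on an interval, and clamping of times *)

Section itv_cover.
Context {R : realType}.

(* A real-induction form of the compactness of [a, b]. *)
Lemma itv_cover_ind (P : R -> R -> Prop) a b : a <= b ->
  (forall x y z, a <= x -> x <= y -> y <= z -> z <= b -> P x y -> P y z -> P x z) ->
  (forall t, t \in `[a, b] -> exists2 e, 0 < e & forall x y, a <= x -> x <= t ->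
     t <= y -> y <= b -> y - x < e -> P x y) ->
  P a b.
Proof.
move=> ab Pglue Ploc.
pose S := [set x | [/\ a <= x, x <= b & P a x]].
have Sa : S a.
  split => //; have [|e e0 He] := Ploc a; first by rewrite in_itv/= lexx.
  by apply: He; rewrite ?subrr.
have supS : has_sup S by split; [exists a|exists b => x []].
have ac : a <= sup S by apply: ub_le_sup => //; exact: supS.2.
have cb : sup S <= b by apply: ge_sup => [|x []//]; exists a.
have [|e e0 He] := Ploc (sup S); first by rewrite in_itv/= ac.
have [x [ax xb Pax] xc] := sup_adherent (divr_gt0 e0 (ltr0Sn R 1)) supS.
have xS : x <= sup S by apply: ub_le_sup => //; exact: supS.2.
(* The local hypothesis joins [x], less than e/2 below the supremum, to [y], at most e/4 above it.
   So [y] is in [S], and y <= sup S forces y = b. *)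
pose y := Num.min (sup S + e / 4) b.
have e4 : 0 < e / 4 by rewrite divr_gt0.
have cy : sup S <= y by rewrite le_min cb lerDl ltW.
have yb : y <= b by rewrite ge_min lexx orbT.
have Pay : P a y.
  apply: (Pglue _ x) => //; first exact: le_trans cy.
  apply: He => //; have : y <= sup S + e / 4 by rewrite ge_min lexx.
  lra.
have Sy : S y by split=> //; exact: le_trans ac cy.
have yc : y <= sup S by apply: ub_le_sup => //; exact: supS.2.
suff <- : y = b by [].
move: yc; rewrite /y; case: (leP (sup S + e / 4) b) => // _; lra.
Qed.

Lemma continuous_ge0_rat (f : R -> R) : continuous f ->
  (forall q : rat, 0 <= f (ratr q)) -> forall t, 0 <= f t.
Proof.
move=> cf fq t; rewrite leNgt; apply/negP => ft.
have : nbhs t [set s | f s < 0] by exact: (cvgr_lt _ (cf t) _ ft).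
rewrite nbhsE => -[U [oU Ut] Uf].
have [x [/Uf fx [q _ qE]]] := @dense_rat R U (ex_intro _ t Ut) oU.
by have := fq q; rewrite qE leNgt => /negP; apply.
Qed.

(** Composition with this projection extends a path from [0, T] to the whole line by its end values,
    with the same Lipschitz constant. *)
Definition clamp (T t : R) := Num.max 0 (Num.min t T).

Lemma clamp_id T t : 0 <= t <= T -> clamp T t = t.
Proof. by move=> /andP[t0 tT]; rewrite /clamp (min_idPl tT) (max_idPr t0). Qed.

Lemma clamp_itv T t : 0 <= T -> 0 <= clamp T t <= T.
Proof. by move=> T0; rewrite le_max lexx/= ge_max T0 ge_min lexx orbT. Qed.

Lemma le_clamp T s t : s <= t -> clamp T s <= clamp T t.
Proof.
by move=> st; rewrite ge_max le_max lexx/= le_max le_min !ge_min lexx st !orbT.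
Qed.

Lemma clampB T s t : s <= t -> clamp T t - clamp T s <= t - s.
Proof.
move=> st; rewrite /clamp.
case: (leP t T) => tT; case: (leP s T) => sT; case: (leP 0 t) => t0;
  case: (leP 0 s) => s0; case: (leP 0 T) => T0; lra.
Qed.

Lemma dist_clamp T s t : `|clamp T t - clamp T s| <= `|t - s|.
Proof.
wlog st : s t / s <= t.
  by move=> H; have [/H//|/ltW/H] := leP s t; rewrite distrC [leRHS]distrC.
by rewrite !ger0_norm ?subr_ge0 ?le_clamp// clampB.
Qed.

Lemma continuous_clamp T : continuous (clamp T).
Proof.
move=> t; apply/cvgrPdist_lt => e e0; exists e => //= s.
by rewrite /ball/=; apply: le_lt_trans; exact: dist_clamp.
Qed.

End itv_cover.

(** * Lipschitz trajectories of differentiable curves in L^oo *)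

Section trajectories.
Context {R : realType} {d : nat}.
Local Notation E := 'rV[R]_d.
Local Notation vol := (lebesgue_rV (R := R) d).
Variables (Omega : set E) (T : R).
Hypothesis T0 : 0 <= T.

Definition ae_bounded (w : E -> E) (c : R) :=
  {ae vol, forall x, Omega x -> `|w x| <= c}.

Lemma norm_le_enorm (v : E) : `|v| <= enorm v.
Proof.
rewrite [leLHS]mx_normrE; apply/bigmax_leP; split; first exact: enorm_ge0.
move=> [i j] _ /=; rewrite (ord1 i) -sqrtr_sqr ler_wsqrtr// expr2.
rewrite /dotp (bigD1 j)//= lerDl sumr_ge0// => k _.
by rewrite -expr2 sqr_ge0.
Qed.

Lemma Linfty_norm_ae_bounded (w : E -> E) (c : R) :
  (Linfty_norm Omega w <= c%:E)%E -> ae_bounded w c.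
Proof.
(* The second case is that of a null whole space, where every property holds almost everywhere. *)
rewrite /Linfty_norm unlock; case: ifPn => [_ /ess_supP|]; last first.
  rewrite -leNgt measure_le0 => /eqP vol0 _; exact: measure0_ae.
apply: filterS => x /= + Ox; rewrite patchE mem_set//= lee_fin ger0_norm ?enorm_ge0//.
exact/le_trans/norm_le_enorm.
Qed.

Lemma C0_X_ae_locally_bounded (f : R -> E -> E) : C0_X Omega T f ->
  forall t, t \in `[0, T] -> exists2 e, 0 < e & exists K,
    forall s, s \in `[0, T] -> `|s - t| < e -> ae_bounded (f s) K.
Proof.
move=> Cf t t0T; have [[[_ ft] _] fcvg] := Cf t t0T.
have [k fk] : exists k, ae_bounded (f t) k.
  move: ft; case E : (Linfty_norm Omega (f t)) => [k| |]// _.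
    by exists k; apply: Linfty_norm_ae_bounded; rewrite E.
  by exists 0; apply: Linfty_norm_ae_bounded; rewrite E leNye.
have /fcvg[e /= e0 He] : nbhs 0%E [set y : \bar R | (y < 1%:E)%E].
  by apply: open_ereal_lt'; rewrite lte_fin.
exists e => //; exists (1 + k) => s s0T ste.
have /ltW/Linfty_norm_ae_bounded : (Linfty_norm Omega (fun x => f s x - f t x)%R < 1%:E)%E.
  by apply: He => //; rewrite /ball/= distrC.
apply: filterS2 fk => x fx fst Ox.
rewrite -(subrK (f t x) (f s x)) (le_trans (ler_normD _ _))// lerD//; [exact: fst|exact: fx].
Qed.

Lemma C0_X_ae_bounded (f : R -> E -> E) : C0_X Omega T f ->
  exists K, forall s, s \in `[0, T] -> ae_bounded (f s) K.
Proof.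
move=> Cf.
pose P x y := exists K, forall s, x <= s <= y -> ae_bounded (f s) K.
suff [K HK] : P 0 T by exists K => s; rewrite in_itv/=; exact: HK.
apply: itv_cover_ind => //.
  move=> x y z _ xy yz _ [K1 H1] [K2 H2]; exists (Num.max K1 K2) => s /andP[xs sz].
  have [sy|/ltW ys] := leP s y.
    have := H1 s; rewrite xs sy => /(_ isT); apply: filterS => v /[apply] /le_trans.
    by apply; rewrite le_max lexx.
  have := H2 s; rewrite ys sz => /(_ isT); apply: filterS => v /[apply] /le_trans.
  by apply; rewrite le_max lexx orbT.
move=> t t0T; have [e e0 [K HK]] := C0_X_ae_locally_bounded Cf t0T.
exists e => // x y x0 xt ty yT xye; exists K => s /andP[xs sy].
apply: HK; first by rewrite in_itv/= (le_trans x0)//= (le_trans sy).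
by rewrite ltr_norml; apply/andP; split; lra.
Qed.

(** Near t the difference quotients are within 1 of the derivative at t, itself bounded by [K],
    hence the slope [1 + K]. Two times on either side of t are compared through t, and real
    induction glues these local estimates. *)
Lemma C1_X_ae_lipschitz (f f' : R -> E -> E) : C0_X Omega T f' ->
  time_derivative_X Omega T f f' ->
  exists K, forall s t, 0 <= s -> s <= t -> t <= T ->
    ae_bounded (fun x => f t x - f s x) (K * (t - s)).
Proof.
move=> Cf' dff'; have [K HK] := C0_X_ae_bounded Cf'.
exists (1 + K) => a b a0 ab bT.
apply: (itv_cover_ind (P := fun s t =>
  ae_bounded (fun x => f t x - f s x) ((1 + K) * (t - s)))) => //.
  move=> x y z _ _ _ _; apply: filterS2 => v fxy fyz Ov.
  rewrite -(subrK (f y v) (f z v)) -addrA (le_trans (ler_normD _ _))//.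
  rewrite [leRHS](_ : _ = (1 + K) * (z - y) + (1 + K) * (y - x)); last by ring.
  by rewrite lerD ?fxy ?fyz.
move=> t; rewrite in_itv/= => /andP[at_ tb].
have t0T : t \in `[0, T] by rewrite in_itv/= (le_trans a0)//= (le_trans tb).
have /(dff' t t0T)[e /= e0 He] : nbhs 0%E [set y : \bar R | (y < 1%:E)%E].
  by apply: open_ereal_lt'; rewrite lte_fin.
have loc s : s \in `[0, T] -> `|s - t| < e ->
    ae_bounded (fun x => f s x - f t x) ((1 + K) * `|s - t|).
  move=> s0T ste; have [->|st] := eqVneq s t.
    by apply: aeW => x _; rewrite !subrr !normr0 mulr0.
  have /ltW/Linfty_norm_ae_bounded : (Linfty_norm Omega
      (fun x => (s - t)^-1 *: (f s x - f t x) - f' t x)%R < 1%:E)%E.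
    by apply: He => //; rewrite /ball/= distrC.
  apply: filterS2 (HK t t0T) => x fx fst Ox.
  have st0 : 0 < `|s - t| by rewrite normr_gt0 subr_eq0.
  rewrite -ler_pdivrMr// mulrC -normfV -normrZ.
  rewrite -(subrK (f' t x) (_ *: _)) (le_trans (ler_normD _ _))// lerD//.
    exact: fst.
  exact: fx.
exists e => // x y ax xt ty yb yxe.
have y0T : y \in `[0, T] by rewrite in_itv/= (le_trans yb bT) andbT; lra.
have x0T : x \in `[0, T] by rewrite in_itv/= (le_trans a0 ax)/=; lra.
have ye : `|y - t| < e by rewrite ger0_norm ?subr_ge0//; lra.
have xe : `|x - t| < e by rewrite ler0_norm ?subr_le0//; lra.
apply: filterS2 (loc _ y0T ye) (loc _ x0T xe) => v fy fx Ov.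
rewrite -(subrK (f t v) (f y v)) -addrA (le_trans (ler_normD _ _))//.
rewrite [leRHS](_ : _ = (1 + K) * `|y - t| + (1 + K) * `|x - t|).
  by rewrite lerD ?fy// distrC fx.
by rewrite ger0_norm ?subr_ge0// ler0_norm ?subr_le0//; ring.
Qed.

Lemma ae_forall_count (I : countType) (P : I -> E -> Prop) :
  (forall i, {ae vol, forall x, P i x}) -> {ae vol, forall x, forall i, P i x}.
Proof.
move=> HP.
have : {ae vol, forall x, forall n, if unpickle n is Some i then P i x else True}.
  by apply: ae_foralln => n; case: unpickle => [i|]; [exact: HP|exact: aeW].
by apply: filterS => x H i; have := H (pickle i); rewrite pickleK.
Qed.

(** The null set of the preceding estimate depends on the two times, so only countably many pairs
    are kept: clamped rationals, which are dense in [0, T]. Continuity then frees one time after the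
    other. *)
Lemma C1_X_lipschitz_trajectories (f f' : R -> E -> E) : C0_X Omega T f' ->
  time_derivative_X Omega T f f' -> continuous_trajectories Omega T f ->
  exists K, {ae vol, forall x, Omega x -> forall s t,
    `|f (clamp T t) x - f (clamp T s) x| <= K * `|t - s|}.
Proof.
move=> Cf' dff' cf; have [K HK] := C1_X_ae_lipschitz Cf' dff'.
exists `|K|.
have : {ae vol, forall x, forall pq : rat * rat, Omega x ->
    `|f (clamp T (ratr pq.2)) x - f (clamp T (ratr pq.1)) x| <=
    `|K| * `|ratr pq.2 - ratr pq.1| }.
  apply: ae_forall_count => -[p q] /=.
  wlog pq : p q / (ratr p : R) <= ratr q.
    move=> H; have [/H//|/ltW/H] := leP (ratr p : R) (ratr q).
    by apply: filterS => x /[apply]; rewrite distrC [X in _ * X]distrC.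
  have [/andP[p0 _] /andP[_ qT]] := (clamp_itv (ratr p) T0, clamp_itv (ratr q) T0).
  have := HK _ _ p0 (le_clamp T pq) qT; apply: filterS => x /[apply] /le_trans; apply.
  rewrite (@le_trans _ _ (`|K| * (clamp T (ratr q) - clamp T (ratr p))))//.
    by rewrite ler_wpM2r ?ler_norm// subr_ge0 le_clamp.
  by rewrite ler_wpM2l// (le_trans (ler_norm _))// dist_clamp.
apply: filterS2 cf => x cfx fx Ox.
have {}cfx : continuous (fun t => f (clamp T t) x).
  move=> t; have /subspace_continuousP := cfx Ox.
  move=> /(_ (clamp T t) (clamp_itv t T0)) cft.
  apply: (cvg_comp (clamp T) (f^~ x) _ cft) => A /= HA.
  have : nbhs t (fun s => clamp T s \in `[0, T] -> A (clamp T s)).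
    exact: (@continuous_clamp R T t _ HA).
  by apply: filterS => s HAs; apply: HAs; rewrite in_itv/= clamp_itv.
have cK (s : R) : continuous (fun t : R => `|K| * `|t - s|).
  move=> t; apply: cvgM; first exact: cvg_cst.
  by apply: cvg_norm; apply: cvgB; [exact: cvg_id|exact: cvg_cst].
have H1 (p : rat) t : `|f (clamp T t) x - f (clamp T (ratr p)) x| <= `|K| * `|t - ratr p|.
  rewrite -subr_ge0; move: t; apply: continuous_ge0_rat => [t|q].
    apply: cvgB; first exact: cK.
    by apply: cvg_norm; apply: cvgB; [exact: cfx|exact: cvg_cst].
  by rewrite subr_ge0; exact: (fx (p, q) Ox).
move=> s t; rewrite -subr_ge0; move: s; apply: continuous_ge0_rat => [s|p].
  apply: cvgB.
    by under eq_fun do rewrite distrC; rewrite distrC; exact: cK.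
  by apply: cvg_norm; apply: cvgB; [exact: cvg_cst|exact: cfx].
by rewrite subr_ge0.
Qed.

End trajectories.

Section derive1_total.
Context {R : realType}.
Implicit Type f : R -> R.

(* [derive1 f t] is the junk value 0 where [f] is not derivable, so that these
   two facts hold without a derivability assumption. *)
Lemma derive1_opp_total f t : derive1 (fun s => - f s) t = - derive1 f t.
Proof.
rewrite /derive1; set q := fun h => h^-1 *: (f (h + t) - f t).
have -> : (fun h => h^-1 *: (- f (h + t) - - f t)) = - q.
  by apply/funext => h; rewrite /q /= -opprD scalerN.
have [cq|ncq] := pselect (cvg (q @ 0^')).
  by apply/cvg_lim => //; exact: cvgN.
have ncNq : ~ cvg ((- q) @ 0^') by move=> /is_cvgN; rewrite opprK.
by rewrite (dvgP ncNq) (dvgP ncq) oppr0.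
Qed.

Lemma derive1_ge0_nondecreasing f t : {homo f : x y / x <= y} -> 0 <= derive1 f t.
Proof.
move=> ndf; rewrite /derive1; set q := fun h => h^-1 *: (f (h + t) - f t).
have [cq|ncq] := pselect (cvg (q @ 0^')); last by rewrite dvgP.
apply: limr_ge => //; apply: nearW => h; rewrite /q.
have [h0|h0] := leP 0 h.
  by rewrite mulr_ge0 ?invr_ge0// subr_ge0 ndf// lerDr.
by rewrite mulr_le0 ?invr_le0 ?subr_le0 ?ndf// ?gerDr ltW.
Qed.

Lemma derive1_near_eq f g t : (\near t, f t = g t) -> derive1 f t = derive1 g t.
Proof. by move=> fg; rewrite !derive1E; exact: near_eq_derive. Qed.

End derive1_total.

(** * The profile [h] of a degradation factor *)

Section degradation_function.
Context {R : realType}.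

Definition degradation_function (h : R -> R) : Prop :=
  [/\ {homo h : x y /~ x <= y}, forall z, 0 <= h z <= 1,
      forall z, derivable h z 1 & continuous (derive1 h)].

(** As a left limit of the constant 1, [h a] is 1 by continuity; this joins the plateau to the
    decreasing part, so that [h] is nonincreasing on the whole line. *)
Lemma degradation_functionP (h : R -> R) (a b : R) : a < b -> smooth h ->
  (forall z, 0 <= h z) -> (forall z, z < a -> h z = 1) ->
  (forall z z', a <= z -> z <= z' -> z' < b -> h z' <= h z) ->
  (forall z, b <= z -> h z = 0) -> degradation_function h /\ h a = 1.
Proof.
move=> ab sh h0 h1 hd hb.
have dh z : derivable h z 1 := sh 0%N z.
have ch : continuous h.
  by move=> z; apply/differentiable_continuous; rewrite -derivable1_diffP.
have ha : h a = 1.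
  have : h x @[x --> a^'-] --> h a by exact/cvg_at_left_filter/ch.
  have h1a : h x @[x --> a^'-] --> (1 : R).
    apply: cvg_trans (@cvg_cst _ (1 : R) _ a^'- _).
    apply: near_eq_cvg; near=> x.
    by rewrite h1//; near: x; exact: nbhs_left_lt.
  by move=> /cvg_unique; apply.
have h1' z : z <= a -> h z = 1 by rewrite le_eqVlt => /predU1P[->|/h1].
have ndh : {homo h : x y /~ x <= y}.
  move=> y x xy.
  have [yb|/hb->//] := ltP y b.
  have [ax|/ltW xa] := leP a x; first exact: hd.
  rewrite (h1' _ xa); have [ay|/ltW/h1'->//] := leP a y.
  by rewrite -ha hd.
split; last exact: ha.
split; [exact: ndh| |exact: dh|].
  move=> z; rewrite h0/=; have [za|/ltW za] := leP z a; first by rewrite h1'.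
  by rewrite -ha ndh.
move=> z; apply/differentiable_continuous; rewrite -derivable1_diffP.
exact: (sh 1%N).
Unshelve. all: by end_near. Qed.

Lemma degradation_function_lipschitz (h : R -> R) : degradation_function h ->
  forall a b, a <= b -> exists2 K, 0 <= K & forall x y, a <= x -> x <= y -> y <= b ->
    h x - h y <= K * (y - x).
Proof.
move=> [ndh _ dh cdh] a b ab.
have cf : {within `[a, b], continuous (fun x => `|derive1 h x|)}.
  by apply: continuous_subspaceT => x; apply: cvg_norm; exact: cdh.
have [c _ Hc] := EVT_max ab cf.
exists `|derive1 h c| => // x y ax xy yb.
have [||z] := @MVT_segment _ h (derive1 h) x y xy.
- by move=> z _; rewrite derive1E; exact/derivableP.
- by apply: derivable_within_continuous => z _; exact: dh.
rewrite in_itv/= => /andP[xz zy] E.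
rewrite -opprB E -mulNr ler_wpM2r ?subr_ge0//.
rewrite (le_trans (ler_norm _))// normrN Hc// in_itv/=.
by rewrite (le_trans ax)//= (le_trans zy).
Qed.

End degradation_function.

Lemma Rintegral_cst_itv_oc {R : realType} (a b k : R) : a <= b ->
  \int[lebesgue_measure]_(s in `]a, b]) k = k * (b - a).
Proof.
move=> ab; rewrite Rintegral_cst; last exact: measurable_itv.
congr (_ * _).
apply: (etrans (congr1 fine (lebesgue_measure_itv (Interval (BRight a) (BRight b))))).
by move: ab; rewrite /= lte_fin le_eqVlt => /predU1P[->|->//]; rewrite ltxx subrr.
Qed.

(** * Summaries of the strain history and the damage that they cause *)

Section memory.
Context {R : realType}.
Local Notation dt := (@lebesgue_measure R).
Variables (rp T : R).

(* [M b] summarises the history of the bond strain [r] over [0, b]. *)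
Definition memory (h r M : R -> R) : Prop :=
  (exists2 K, 0 <= K & forall a b, 0 <= a -> a <= b -> b <= T ->
     0 <= M b - M a <= K * (b - a)) /\
  (forall a b, 0 <= a -> a <= b -> b <= T ->
     (forall s, a <= s <= b -> r s <= rp) -> h (M b) = h (M a)).

Variables (r : R -> R) (L : R).
Hypotheses (L0 : 0 <= L) (lipr : forall s t, `|r t - r s| <= L * `|t - s|).

Let cr : continuous r := lipschitz_continuous L0 lipr.

Let rK s : 0 <= s -> s <= T -> `|r s| <= `|r 0| + L * T.
Proof.
move=> s0 sT; rewrite -(subrK (r 0) (r s)) (le_trans (ler_normD _ _))// addrC lerD2l.
by rewrite (le_trans (lipr _ _))// ler_wpM2l// subr0 ger0_norm.
Qed.

(** An increment of the summary is the integral of the excess of [r] over [rp]: nonnegative, at most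
    a bound on the excess times the elapsed time, and zero while r <= rp. *)
Lemma memory_integral h :
  memory h r (fun t => \int[dt]_(s in `[0, t]) Num.max (r s - rp) 0).
Proof.
set p := fun s => Num.max (r s - rp) 0; set M := fun t => _.
have cp : continuous p.
  move=> s; apply: (@continuous_max _ _ (fun s => r s - rp) (cst 0)).
    by apply: cvgB; [exact: cr|exact: cvg_cst].
  exact: cvg_cst.
have ic (f : R -> R) a b : continuous f -> dt.-integrable `[a, b] (EFin \o f).
  move=> cf; apply: continuous_compact_integrable; first exact: segment_compact.
  exact: continuous_subspaceT.
have p0 s : 0 <= p s by rewrite le_max lexx orbT.
have MB a b : 0 <= a -> a <= b -> M b - M a = \int[dt]_(s in `]a, b]) p s.
  by move=> a0 ab; rewrite /M Rintegral_itvB//; exact: ic.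
have icoc (f : R -> R) a b : continuous f -> dt.-integrable `]a, b] (EFin \o f).
  move=> cf; apply: integrableS (ic f a b cf) => //.
  by apply: subset_itv; rewrite bnd_simp.
split.
  pose K : R := `|r 0| + L * `|T| + `|rp|.
  exists K => [|a b a0 ab bT]; first by rewrite !addr_ge0 ?mulr_ge0.
  rewrite MB// Rintegral_ge0//=.
  rewrite (@le_trans _ _ (\int[dt]_(s in `]a, b]) K))//; last first.
    by rewrite Rintegral_cst_itv_oc.
  apply: le_Rintegral => //; [exact: icoc|by apply: icoc => s; exact: cvg_cst|].
  move=> s /=; rewrite in_itv/= => /andP[as_ sb].
  rewrite ge_max !addr_ge0 ?mulr_ge0// andbT lerD//; last by rewrite -normrN ler_norm.
  rewrite (le_trans (ler_norm _))// (le_trans (rK _ (le_trans sb bT)))//.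
    exact/ltW/(le_lt_trans a0).
  by rewrite lerD2l ler_wpM2l// ler_norm.
move=> a b a0 ab bT Hr; congr h; apply/eqP; rewrite -subr_eq0 MB//.
rewrite (@eq_Rintegral _ _ _ _ _ (cst 0)); first by rewrite Rintegral_cst// mul0r.
move=> s; rewrite inE/= in_itv/= => /andP[as_ sb].
by apply/max_idPr; rewrite subr_le0 Hr// (ltW as_).
Qed.

(** After time a, [r] exceeds [r a] by at most L times the elapsed time, which bounds the growth of
    the maximum. While r <= rp the maximum may still grow, but only below [rp], where [h] is 1; this
    is why [memory] compares values of [h]. *)
Lemma memory_sup (h : R -> R) : (forall z, z <= rp -> h z = 1) ->
  memory h r (fun t => sup [set r s | s in `[0, t]]).
Proof.
move=> h1; set M := fun t => _.
have supP t : 0 <= t -> t <= T -> has_sup [set r s | s in `[0, t]].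
  move=> t0 tT; split; first by exists (r 0), 0 => //=; rewrite in_itv/= lexx.
  exists (`|r 0| + L * T) => _ [s /= + <-]; rewrite in_itv/= => /andP[s0 st].
  by rewrite (le_trans (ler_norm _))// rK// (le_trans st).
have leM s t : 0 <= s -> s <= t -> t <= T -> r s <= M t.
  move=> s0 st tT; apply: ub_le_sup; first exact: (supP t (le_trans s0 st) tT).2.
  by exists s => //=; rewrite in_itv/= s0.
have Mle t c : 0 <= t -> t <= T -> (forall s, 0 <= s -> s <= t -> r s <= c) -> M t <= c.
  move=> t0 tT H; apply: ge_sup; first exact: (supP t t0 tT).1.
  by move=> _ [s /= + <-]; rewrite in_itv/= => /andP[]; exact: H.
have ndM a b : 0 <= a -> a <= b -> b <= T -> M a <= M b.
  move=> a0 ab bT; apply: Mle => //; first exact: le_trans bT.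
  by move=> s s0 sa; apply: leM => //; exact: le_trans ab.
split.
  exists L => // a b a0 ab bT; have aT := le_trans ab bT.
  rewrite subr_ge0 ndM//= lerBlDl; apply: Mle => // [|s s0 sb].
    exact: le_trans ab.
  have [sa|/ltW as_] := leP s a.
    by rewrite ler_wpDr ?leM// mulr_ge0// subr_ge0.
  rewrite -(subrK (r a) (r s)) addrC lerD ?leM//.
  rewrite (le_trans (ler_norm _))// (le_trans (lipr _ _))// ler_wpM2l//.
  by rewrite ger0_norm ?subr_ge0// lerD2r.
move=> a b a0 ab bT Hr; have aT := le_trans ab bT; have b0 := le_trans a0 ab.
have Mab := ndM _ _ a0 ab bT.
have Mb : M b <= Num.max (M a) rp.
  apply: Mle => // s s0 sb; rewrite le_max; have [sa|/ltW as_] := leP s a.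
    by rewrite leM.
  by rewrite Hr ?orbT// as_.
have [rpM|/ltW Mrp] := leP rp (M a).
  by congr h; apply/eqP; rewrite eq_le Mab andbT; rewrite (max_idPl rpM) in Mb.
by rewrite (max_idPr Mrp) in Mb; rewrite !h1.
Qed.

Variables (h M g : R -> R) (Cp : R).
Hypotheses (T0 : 0 <= T) (dh : degradation_function h) (mM : memory h r M)
  (gCp : forall z, rp <= z -> g z = Cp).

Let G t := h (M (clamp T t)).

Lemma memory_degradation_nonincreasing : {homo G : x y /~ x <= y}.
Proof.
have [ndh _ _ _] := dh; have [[K _ HK] _] := mM.
move=> y x xy; apply: ndh; rewrite -subr_ge0.
have [/andP[x0 _] /andP[_ yT]] := (clamp_itv x T0, clamp_itv y T0).
by have /andP[] := HK _ _ x0 (le_clamp T xy) yT.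
Qed.

(** The summary stays in the compact interval from [M 0] to [M T], on which [h] is Lipschitz. *)
Lemma memory_degradation_lipschitz : exists K, forall x y, x <= y ->
  G x - G y <= K * (y - x).
Proof.
have [[K K0 HK] _] := mM.
have M0T : M 0 <= M T by rewrite -subr_ge0; have /andP[] := HK _ _ (lexx 0) T0 (lexx T).
have [K' K'0 HK'] := degradation_function_lipschitz dh M0T.
exists (K' * K) => x y xy.
have [/andP[x0 xT] /andP[y0 yT]] := (clamp_itv x T0, clamp_itv y T0).
have cxy := le_clamp T xy; have /andP[] := HK _ _ x0 cxy yT.
rewrite subr_ge0 => Mxy0 Mxy.
have /andP[] := HK _ _ (lexx 0) x0 xT; rewrite subr_ge0 => M0x _.
have /andP[] := HK _ _ y0 yT (lexx T); rewrite subr_ge0 => MyT _.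
apply: (le_trans (HK' _ _ M0x Mxy0 MyT)).
rewrite -mulrA ler_wpM2l// (le_trans Mxy)// ler_wpM2l//.
exact: clampB.
Qed.

Lemma memory_degradation_damage t : 0 < t < T ->
  derive1 G t * g (r t) = derive1 G t * Cp.
Proof.
move=> /andP[t0 tT]; have [rt|rt] := leP rp (r t); first by rewrite gCp.
have [_ HM] := mM.
suff -> : derive1 G t = 0 by rewrite !mul0r.
have : nbhs t [set s | r s < rp].
  have crt : r @ t --> r t by exact: cr.
  exact: (cvgr_lt _ crt _ rt).
have : nbhs t [set s | 0 < s < T].
  have : \near t, t \in `]0, T[ by apply: near_in_itvoo; rewrite in_itv/= t0.
  by apply: filterS => s; rewrite in_itv.
move=> /[swap] /filterI /[apply] /nbhs_ballP[e /= e0 He].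
rewrite (@derive1_near_eq _ _ (cst (G t))); first exact: derive1_cst.
exists e => // s /= ste; rewrite /G.
have Hball x y u : ball t e x -> ball t e y -> x <= u <= y -> r u <= rp.
  rewrite /ball/= => tx ty /andP[xu uy]; apply/ltW.
  suff /He[] : ball t e u by [].
  move: tx ty; rewrite /ball/= !ltr_norml => /andP[? ?] /andP[? ?].
  by apply/andP; split; lra.
have [_ /andP[s0 sT]] := He s ste.
have Bt : ball t e t by exact: ballxx.
rewrite !clamp_id ?(ltW s0) ?(ltW sT) ?(ltW t0) ?(ltW tT)//.
have [st|/ltW ts] := leP s t.
  by apply/esym; apply: HM => //; [exact: ltW|exact: ltW|move=> u; exact: Hball].
by apply: HM => //; [exact: ltW|exact: ltW|move=> u; exact: Hball].
Qed.

End memory.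

(** * Both degradation factors as functions of the strain history *)

Section history.
Context {R : realType}.
Local Notation dt := (@lebesgue_measure R).

(** For unbounded [A] and c > 0 both suprema take the default value 0. *)
Lemma sup_mull (c : R) (A : set R) : 0 <= c -> A !=set0 ->
  sup [set c * x | x in A] = c * sup A.
Proof.
move=> + A0; rewrite le_eqVlt => /predU1P[<-|c0].
  rewrite mul0r (_ : [set _ | _ in _] = [set 0]) ?sup1//.
  apply/seteqP; split => [_ [x _ <-]|_ ->]; first by rewrite mul0r.
  by have [x Ax] := A0; exists x; rewrite ?mul0r.
have cA0 : [set c * x | x in A] !=set0 by have [x Ax] := A0; exists (c * x), x.
have [[B AB]|nA] := pselect (has_ubound A).
  have cAB : has_ubound [set c * x | x in A].
    by exists (c * B) => _ [x Ax <-]; rewrite ler_wpM2l ?AB// ltW.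
  apply/eqP; rewrite eq_le; apply/andP; split.
    apply: ge_sup => // _ [x Ax <-]; apply: (ler_wpM2l (ltW c0)).
    by apply: ub_le_sup => //; exists B.
  rewrite mulrC -ler_pdivlMr//; apply: ge_sup => // x Ax.
  rewrite ler_pdivlMr// mulrC; by apply: ub_le_sup => //; exists x.
rewrite !sup_out ?mulr0// => -[_ //] [B cAB]; apply: nA; exists (c^-1 * B) => x Ax.
by rewrite ler_pdivlMl// cAB//; exists x.
Qed.

(* The common form of the two degradation factors: a decreasing function [h] of
   a summary [Mem] of the history of the scaled strain of the bond. *)
Record history_degradation d rp (gamma : degradation R d) (h : R -> R)
    (Mem : (R -> R) -> R -> R) : Prop := {
  history_function : degradation_function h ;
  history_memory : forall T r L, 0 <= L ->
    (forall s t, `|r t - r s| <= L * `|t - s|) -> memory rp T h r (Mem r) ;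
  history_local : forall r r' t, (forall s, 0 <= s <= t -> r s = r' s) ->
    Mem r t = Mem r' t ;
  history_measurable : forall d' (Z : measurableType d') (r : R -> Z -> R),
    (forall t, measurable_fun setT (r t)) ->
    (forall z, exists2 L, 0 <= L & forall s t, `|r t z - r s z| <= L * `|t - s|) ->
    forall t, 0 <= t -> measurable_fun setT (fun z => Mem (r^~ z) t) ;
  history_gammaE : forall u x y t, 0 <= t ->
    gamma u y x t = h (Mem (fun s => scaled_strain y x (u s)) t) }.

Lemma measurable_memory_integral d' (Z : measurableType d') (r : R -> Z -> R) rp t :
  (forall t, measurable_fun setT (r t)) ->
  (forall z, exists2 L, 0 <= L & forall s t, `|r t z - r s z| <= L * `|t - s|) ->
  measurable_fun setT (fun z => \int[dt]_(s in `[0, t]) Num.max (r s z - rp) 0).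
Proof.
move=> mr lipr.
have mr' : measurable_fun setT (fun p : Z * measurableTypeR R => r p.2 p.1).
  have H : measurable_fun setT (fun p : measurableTypeR R * Z => r p.1 p.2).
    apply: measurable_caratheodory => // z.
    by have [L L0 /(lipschitz_continuous L0)] := lipr z.
  have sw : measurable_fun setT (fun p : Z * measurableTypeR R => (p.2, p.1)).
    by apply: measurable_fun_pair; [exact: measurable_snd|exact: measurable_fst].
  exact: (measurableT_comp H sw).
apply: (measurableT_comp (f := fine)); first exact: fine_measurable.
apply: (@measurable_fun_integral_dom _ _ _ _ _ dt _ _
  (fun p : Z * measurableTypeR R => (Num.max (r p.2 p.1 - rp) 0)%:E)).
- exact: measurable_itv.
- apply/measurable_EFinP; apply: measurable_maxr => //.
  exact: measurable_funB.
- by move=> p; rewrite lee_fin le_max lexx orbT.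
Qed.

(** By continuity in time, the supremum over [0, t] equals the supremum over the clamped rationals,
    a countable family. *)
Lemma measurable_memory_sup d' (Z : measurableType d') (r : R -> Z -> R) t : 0 <= t ->
  (forall t, measurable_fun setT (r t)) ->
  (forall z, exists2 L, 0 <= L & forall s t, `|r t z - r s z| <= L * `|t - s|) ->
  measurable_fun setT (fun z => sup [set r s z | s in `[0, t]]).
Proof.
move=> t0 mr lipr.
pose q n : R := clamp t (ratr (odflt 0 (unpickle n))).
have q0t n : 0 <= q n <= t by exact: clamp_itv.
have bd z : has_ubound [set r s z | s in `[0, t]].
  have [L L0 HL] := lipr z; exists (`|r 0 z| + L * t) => _ [s /= + <-].
  rewrite in_itv/= => /andP[s0 st]; rewrite (le_trans (ler_norm _))//.
  rewrite -(subrK (r 0 z) (r s z)) (le_trans (ler_normD _ _))// addrC lerD2l.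
  by rewrite (le_trans (HL _ _))// ler_wpM2l// subr0 ger0_norm.
have qA z n : [set r s z | s in `[0, t]] (r (q n) z).
  by exists (q n) => //=; rewrite in_itv/= q0t.
rewrite (_ : (fun z => _) = fun z => sups (fun n => r (q n) z) 0%N).
  apply: (@measurable_fun_sups _ _ _ _ (fun n z => r (q n) z)) => [z _|n]; last exact: mr.
  by have [B HB] := bd z; exists B => _ [n _ <-]; apply: HB; exact: qA.
apply/funext => z.
pose A := [set r s z | s in `[0, t]]; pose B := sdrop (fun n => r (q n) z) 0%N.
rewrite -/A -[RHS]/(sup B).
have [A0 B0] : A !=set0 /\ B !=set0.
  by split; [exists (r (q 0%N) z); exact: qA|exists (r (q 0%N) z), 0%N].
have BA : B `<=` A by move=> _ [n _ <-]; exact: qA.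
have ubB : has_ubound B by have [b Hb] := bd z; exists b => y /BA; exact: Hb.
apply/eqP; rewrite eq_le; apply/andP; split; last first.
  by apply: ge_sup => // y /BA Ay; apply: ub_le_sup => //; exact: bd.
apply: ge_sup => // _ [s /= + <-]; rewrite in_itv/= => s0t.
have [L L0 HL] := lipr z.
have cr : continuous (r^~ z) := lipschitz_continuous L0 HL.
rewrite -subr_ge0 -(clamp_id s0t); move: s {s0t}.
apply: continuous_ge0_rat => [s|p].
  apply: cvgB; first exact: cvg_cst.
  by apply: (cvg_comp (clamp t) (r^~ z)); [exact: continuous_clamp|exact: cr].
rewrite subr_ge0; apply: ub_le_sup => //; exists (pickle p) => //=.
by rewrite /q pickleK.
Qed.

Lemma cumulative_history d rp (gamma : degradation R d) :
  cumulative_degradation rp gamma -> exists h Mem,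
  history_degradation rp gamma h Mem /\ forall r, h (Mem r 0) = 1.
Proof.
move=> [h [xD [[xD0 sh h0 h1 [hd hx]] ->]]].
have [dh h01] := degradation_functionP xD0 sh h0 h1 hd hx.
exists h, (fun r t => \int[dt]_(s in `[0, t]) Num.max (r s - rp) 0); split.
  split => //.
  - by move=> T r L L0 lipr; exact: (memory_integral rp T L0 lipr h).
  - move=> r r' t rr'; apply: eq_Rintegral => s; rewrite inE/= in_itv/= => st.
    by rewrite rr'.
  - by move=> d' Z r mr lipr t t0; exact: measurable_memory_integral.
by move=> r; rewrite set_itv1 Rintegral_set1.
Qed.

(** The factor sqrt|y - x| is nonnegative and moves inside the supremum, which leaves a running
    maximum of the scaled strain, the quantity compared with [rp]. *)
Lemma max_history d rp (gamma : degradation R d) :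
  max_degradation rp gamma -> exists h Mem, history_degradation rp gamma h Mem.
Proof.
move=> [h [rD [[rpD sh h0 h1 [hd hx]] ->]]].
have [dh hrp] : degradation_function h /\ h rp = 1.
  apply: (degradation_functionP rpD sh h0) => // [z /ltW|z z' rz zz' /ltW]; first exact: h1.
  exact: hd.
exists h, (fun r t => sup [set r s | s in `[0, t]]); split => //.
- by move=> T r L L0 lipr; exact: (memory_sup T L0 lipr h1).
- move=> r r' t rr'; congr sup; apply/seteqP.
  by split => _ [s /= + <-]; rewrite in_itv/= => st; exists s; rewrite /= ?in_itv// rr'.
- by move=> d' Z r mr lipr t t0; exact: measurable_memory_sup.
move=> u x y t t0; congr h; rewrite -sup_mull ?sqrtr_ge0//; last first.
  by exists (strain y x (u 0)), 0 => //=; rewrite in_itv/= lexx.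
congr sup; apply/seteqP; split => [_ [_ [s st <-] <-]|_ [s st <-]]; first by exists s.
by exists (strain y x (u s)) => //; exists s.
Qed.

End history.

Section strain_lipschitz.
Context {R : realType} {d : nat}.
Local Notation E := 'rV[R]_d.

(** For a fixed bond the scaled strain is linear in w(y) - w(x). The constant may blow up as y
    approaches x: one constant per bond is enough. *)
Lemma scaled_strain_lipschitz (y x : E) : exists2 C, 0 <= C & forall w w' : E -> E,
  `|scaled_strain y x w - scaled_strain y x w'| <=
  C * (`|w y - w' y| + `|w x - w' x|).
Proof.
pose c i := Num.sqrt (enorm (y - x)) * ((enorm (y - x))^-1 * direction y x ord0 i).
exists (\sum_i `|c i|) => [|w w']; first exact: sumr_ge0.
have E0 (v : E -> E) : scaled_strain y x v = \sum_i c i * (v y - v x) ord0 i.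
  rewrite /scaled_strain /strain /dotp mulr_sumr; apply: eq_bigr => i _.
  by rewrite /c [X in X * direction _ _ _ _]mxE; ring.
rewrite !E0 -sumrB mulr_suml (le_trans (ler_norm_sum _ _ _))//.
apply: ler_sum => i _; rewrite -mulrBr normrM ler_wpM2l//.
rewrite (_ : _ - _ = (w y - w' y) ord0 i - (w x - w' x) ord0 i); last first.
  by rewrite !mxE; ring.
by rewrite (le_trans (ler_normB _ _))// lerD// norm_coord_le.
Qed.

End strain_lipschitz.

(** * Integrating the damage rate over time and over all bonds *)

Section iterated_Rintegral.
Context d2 d3 (T2 : measurableType d2) (T3 : measurableType d3) (R : realType).
Variables (m2 : {measure set T2 -> \bar R})
  (m3 : {sigma_finite_measure set T3 -> \bar R}).
Variables (D2 : set T2) (D3 : set T3).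
Hypotheses (mD2 : measurable D2) (mD3 : measurable D3).
Variable f : T2 * T3 -> R.
Hypotheses (mf : measurable_fun setT f) (f0 : forall p, 0 <= f p).

Let mEf : measurable_fun setT (EFin \o f). Proof. exact/measurable_EFinP. Qed.

Lemma measurable_Rintegral_dom :
  measurable_fun setT (fun x => \int[m3]_(y in D3) f (x, y)).
Proof.
apply: (measurableT_comp (f := fine)); first exact: fine_measurable.
by apply: (@measurable_fun_integral_dom _ _ _ _ _ m3 _ mD3 (EFin \o f)) => // p;
  rewrite lee_fin.
Qed.

Lemma ge0_Rintegral2Zl c : \int[m2]_(x in D2) \int[m3]_(y in D3) (c * f (x, y)) =
  c * \int[m2]_(x in D2) \int[m3]_(y in D3) f (x, y).
Proof.
rewrite -ge0_RintegralZl//; last 2 first.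
- by apply: measurable_funS measurable_Rintegral_dom.
- by move=> x _; apply: Rintegral_ge0.
apply: eq_Rintegral => x _; rewrite ge0_RintegralZl//.
apply: measurable_funTS; apply: (measurableT_comp mf).
by apply: measurable_fun_pair.
Qed.

End iterated_Rintegral.

Section iterated_damage.
Context d2 d3 (T2 : measurableType d2) (T3 : measurableType d3) (R : realType).
Local Notation dt := (@lebesgue_measure R).
Variables (m2 : {sigma_finite_measure set T2 -> \bar R})
  (m3 : {sigma_finite_measure set T3 -> \bar R}).
Variables (D2 : set T2) (D3 : set T3).
Hypotheses (mD2 : measurable D2) (mD3 : measurable D3).
Hypotheses (D2oo : (m2 D2 < +oo)%E) (D3oo : (m3 D3 < +oo)%E).
Variables (k : T2 * T3 -> R) (B : R) (G : R -> T2 * T3 -> R).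
Hypotheses (mk : measurable_fun setT k) (k0 : forall p, 0 <= k p)
  (kB : forall p, k p <= B).
Hypotheses (mG : forall t, measurable_fun setT (G t))
  (niG : forall p, {homo G^~ p : s t /~ s <= t})
  (lipG : forall p, exists K, forall s t, s <= t -> G s p - G t p <= K * (t - s))
  (G01 : forall t p, 0 <= G t p <= 1).

Let cG p : continuous (G^~ p).
Proof.
have [K HK] := lipG p.
apply: (@lipschitz_continuous _ _ `|K|) => // s t.
wlog st : s t / s <= t.
  by move=> H; have [/H//|/ltW/H] := leP s t; rewrite distrC [X in _ * X]distrC.
rewrite ler0_norm ?subr_le0 ?niG// opprB [X in _ <= _ * X]ger0_norm ?subr_ge0//.
by rewrite (le_trans (HK _ _ st))// ler_wpM2r ?subr_ge0// ler_norm.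
Qed.

Let f (q : measurableTypeR R * (T2 * T3)) := k q.2 * - derive1 (G^~ q.2) q.1.

Let mf : measurable_fun setT f.
Proof.
apply: measurable_funM; first exact: (measurableT_comp mk measurable_snd).
by apply: measurable_funN; exact: measurable_derive1.
Qed.

Let G'0 p s : 0 <= - derive1 (G^~ p) s.
Proof.
rewrite -derive1_opp_total; apply: derive1_ge0_nondecreasing => x y xy.
by rewrite lerN2 niG.
Qed.

Let f0 q : 0 <= f q. Proof. by rewrite mulr_ge0. Qed.

Let int_f (t : R) p : 0 <= t ->
  (\int[dt]_(s in `[0%R, t]) (f (s, p))%:E = (k p * (G 0 p - G t p))%:E)%E.
Proof.
move=> t0.
transitivity (\int[dt]_(s in `[0%R, t]) ((k p)%:E * (- derive1 (G^~ p) s)%:E))%E.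
  by apply: eq_integral => s _; rewrite -EFinM.
rewrite ge0_integralZl//; last 3 first.
- apply/measurable_EFinP/measurable_funTS/measurable_funN.
  have H := measurable_derive1 mG cG.
  apply: (measurableT_comp H (g := fun s => (s, p))).
  by apply: measurable_fun_pair.
- by move=> s _; rewrite lee_fin.
- by rewrite lee_fin.
rewrite EFinM; congr (_ * _)%E.
have [K HK] := lipG p.
under eq_integral do rewrite -derive1_opp_total.
rewrite (@lipschitz_FTC R (fun s => - G s p) K)//.
- by rewrite opprK addrC.
- by move=> x y xy; rewrite lerN2 niG.
- by move=> x y xy; rewrite opprK addrC HK.
Qed.

(** Once time is integrated, the integrand k (G(0) - G(t)) is at most [B] because [G] has values in
    [0, 1]. The domains have finite measure, which gives the finiteness that [Rintegral3_rotate]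
    asks for. *)
Lemma iterated_damage t : 0 <= t ->
  \int[dt]_(s in `[0, t]) \int[m2]_(x in D2) \int[m3]_(y in D3)
    (k (x, y) * - derive1 (G^~ (x, y)) s) =
  \int[m2]_(x in D2) \int[m3]_(y in D3) (k (x, y) * (G 0 (x, y) - G t (x, y))).
Proof.
move=> t0.
pose c p := k p * (G 0 p - G t p).
have c0 p : 0 <= c p by rewrite mulr_ge0// subr_ge0 niG.
have cB p : c p <= B.
  have /andP[Gt0 _] := G01 t p; have /andP[_ G01p] := G01 0 p.
  by rewrite -[leRHS]mulr1 ler_pM// ?subr_ge0 ?niG//; lra.
have mc : measurable_fun setT c.
  by apply: measurable_funM => //; exact: measurable_funB.
have mcx x : measurable_fun setT (fun y => (c (x, y))%:E).
  apply/measurable_EFinP; apply: (measurableT_comp mc).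
  by apply: measurable_fun_pair.
have cxB x : (\int[m3]_(y in D3) (c (x, y))%:E <= `|B|%:E * m3 D3)%E.
  rewrite -integral_cst//; apply: ge0_le_integral => //.
  - by move=> y _; rewrite lee_fin.
  - exact: measurable_funTS.
  - by move=> y _; rewrite lee_fin (le_trans (cB _))// ler_norm.
have cE : (\int[m2]_(x in D2) \int[m3]_(y in D3) (c (x, y))%:E < +oo)%E.
  apply: (@le_lt_trans _ _ (\int[m2]_(x in D2) (`|B|%:E * m3 D3))%E).
    apply: ge0_le_integral => //.
    - by move=> x _; apply: integral_ge0 => y _; rewrite lee_fin.
    - apply: measurable_funTS.
      apply: (@measurable_fun_integral_dom _ _ _ _ _ m3 _ mD3 (EFin \o c)) => //.
      exact/measurable_EFinP.
  have D2fin : m2 D2 \is a fin_num by rewrite ge0_fin_numE.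
  have D3fin : m3 D3 \is a fin_num by rewrite ge0_fin_numE.
  by rewrite integral_cst// ltey_eq !fin_numM.
have IE : (\int[m2]_(x in D2) \int[m3]_(y in D3) \int[dt]_(s in `[0%R, t])
    (f (s, (x, y)))%:E = \int[m2]_(x in D2) \int[m3]_(y in D3) (c (x, y))%:E)%E.
  by apply: eq_integral => x _; apply: eq_integral => y _; rewrite int_f.
rewrite (@Rintegral3_rotate _ _ _ _ _ _ _ dt m2 m3 _ _ _ _ mD2 mD3 _ mf f0).
- rewrite IE; congr fine; apply/esym.
  apply: (@integral_fine _ _ _ m2 _ mD2 (fun x => \int[m3]_(y in D3) (c (x, y))%:E)%E).
  + apply: (@measurable_fun_integral_dom _ _ _ _ _ m3 _ mD3 (EFin \o c)) => //.
    exact/measurable_EFinP.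
  + by move=> x; apply: integral_ge0 => y _; rewrite lee_fin.
  + exact: cE.
- exact: measurable_itv.
- by rewrite IE.
Qed.

(** A constant of any sign leaves the real integrals level by level, since at each level the
    remaining integrand is nonnegative and measurable. *)
Lemma iterated_damageZl t c : 0 <= t ->
  \int[dt]_(s in `[0, t]) \int[m2]_(x in D2) \int[m3]_(y in D3)
    (c * (k (x, y) * - derive1 (G^~ (x, y)) s)) =
  c * \int[m2]_(x in D2) \int[m3]_(y in D3) (k (x, y) * (G 0 (x, y) - G t (x, y))).
Proof.
move=> t0; rewrite -iterated_damage//.
have mf1 : measurable_fun setT (fun q : (measurableTypeR R * T2) * T3 =>
    f (q.1.1, (q.1.2, q.2))).
  apply: (measurableT_comp mf); apply: measurable_fun_pair.
    exact: measurableT_comp measurable_fst.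
  apply: measurable_fun_pair; last exact: measurable_snd.
  exact: measurableT_comp measurable_fst.
have mf2 := measurable_Rintegral_dom m3 mD3 mf1 (fun q => f0 _).
have mf3 := measurable_Rintegral_dom m2 mD2 mf2
  (fun q => Rintegral_ge0 m3 (fun x _ => f0 _)).
rewrite -ge0_RintegralZl; last 3 first.
- exact: measurable_itv.
- exact: measurable_funTS mf3.
- move=> s _; apply: Rintegral_ge0 => x _; apply: Rintegral_ge0 => y _.
  exact: (f0 (s, (x, y))).
apply: eq_Rintegral => s _.
apply: (@ge0_Rintegral2Zl _ _ _ _ _ m2 m3 _ _ mD2 mD3 (fun p => f (s, p))).
  by apply: (measurableT_comp mf); exact: measurable_fun_pair.
by move=> p; exact: (f0 (s, p)).
Qed.

End iterated_damage.

Theorem mainTheorem3 (R : realType) (d : nat) (d23 : d = 2%N \/ d = 3%N)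
  (Omega : set 'rV[R]_d) (domOmega : bounded_domain Omega)
  (T eps rho : R) (T0 : 0 < T) (eps0 : 0 < eps) (rho0 : 0 < rho)
  (J : R -> R) (M : R) (hJ : influence_function J M)
  (rm re rc rp Cm Cp : R) (g : R -> R)
  (hg : cohesive_potential rm re rc rp Cm Cp g)
  (gamma : degradation R d)
  (hgamma : cumulative_degradation rp gamma \/ max_degradation rp gamma)
  (b : R -> 'rV[R]_d -> 'rV[R]_d) (hb : C0_X Omega T b)
  (u0 v0 : 'rV[R]_d -> 'rV[R]_d) (hu0 : in_X Omega u0) (hv0 : in_X Omega v0)
  (u u' u'' : R -> 'rV[R]_d -> 'rV[R]_d)
  (hu : solution Omega T rho eps J g gamma b u0 v0 u u' u'')
  (ucont : continuous_trajectories Omega T u)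
  (intact : max_degradation rp gamma -> initially_undamaged Omega eps gamma u)
  (t : R) (t0T : t \in `[0, T]) :
  damage_energy Omega J eps g gamma u t =
  \int[lebesgue_rV d]_(x in Omega) \int[lebesgue_rV d]_(y in Omega)
    (nonlocal_kernel Omega J eps y x * Cp * (1 - gamma u y x t)).
Proof.
have T0' : 0 <= T := ltW T0.
move: t0T; rewrite in_itv/= => /andP[t0 tT].
have [_ oO _ bO] := domOmega.
have mO := open_measurable_rV oO.
have Ooo := bounded_lebesgue_rV mO bO.
have [[Cu Cu' _ du _] _ _ _] := hu.
have [K HK] := C1_X_lipschitz_trajectories T0' Cu' du ucont.
have [h [Mem [hist undamaged]]] : exists h Mem,
    history_degradation rp gamma h Mem /\ initially_undamaged Omega eps gamma u.
  case: hgamma => [/cumulative_history[h [Mem [hist hM]]]|mgamma].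
    exists h, Mem; split => //.
    apply: aeW => x _; apply: aeW => y _ _; rewrite (history_gammaE hist)//; exact: hM.
  by have [h [Mem hist]] := max_history mgamma; exists h, Mem; split => //; exact: intact.
have [dh hmem hloc hmeas gammaE] := hist.
case: HK => N [mN N0 HN].
have aeN : {ae lebesgue_rV d, forall x, ~ N x}.
  by exists N; split => // x /= /contrapT.
pose O' := Omega `\` N.
have mO' : measurable O' by exact: measurableD.
(* The regular copy of [u]: measurable in space at every time and Lipschitz in time at every
   point. *)
pose ub s : 'rV[R]_d -> 'rV[R]_d := u (clamp T s) \_ O'.
have ubE s x : 0 <= s <= T -> O' x -> ub s x = u s x.
  by move=> sT Ox; rewrite /ub patchE mem_set// clamp_id.
have mub s : measurable_fun setT (ub s).
  apply/(measurable_restrictT _ mO').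
  have cs : clamp T s \in `[0, T] by rewrite in_itv/= clamp_itv.
  have [[[mu _] _] _] := Cu _ cs.
  by apply: measurable_funS mu => // x [].
have lipub x s s' : `|ub s' x - ub s x| <= `|K| * `|s' - s|.
  rewrite /ub !patchE; case: ifPn => [/set_mem[Ox Nx]|_]; last first.
    by rewrite subrr normr0 mulr_ge0.
  have : `|u (clamp T s') x - u (clamp T s) x| <= K * `|s' - s|.
    by apply: contrapT => H; apply: Nx; apply: HN => /= /(_ Ox).
  by move=> /le_trans; apply; rewrite ler_wpM2r// ler_norm.
pose r s (p : 'rV[R]_d * 'rV[R]_d) := scaled_strain p.2 p.1 (ub s).
have mr s : measurable_fun setT (r s).
  exact: measurable_scaled_strain.
have lipr p : exists2 L, 0 <= L & forall s s', `|r s' p - r s p| <= L * `|s' - s|.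
  have [C C0 HC] := scaled_strain_lipschitz p.2 p.1.
  exists (C * (`|K| + `|K|)) => [|s s']; first by rewrite mulr_ge0// addr_ge0.
  rewrite (le_trans (HC _ _))// -mulrA ler_wpM2l// mulrDl lerD//; exact: lipub.
pose G s p := h (Mem (r^~ p) (clamp T s)).
have [nih h01 _ _] := dh.
have mG s : measurable_fun setT (G s).
  have mh : measurable_fun setT h.
    apply: nonincreasing_measurable; first exact: measurableT.
    by move=> x y xy; exact: nih.
  apply: (measurableT_comp mh); apply: hmeas => //.
  by have /andP[] := clamp_itv s T0'.
have niG p : {homo G^~ p : s s' /~ s <= s'}.
  have [L L0 HL] := lipr p.
  exact: memory_degradation_nonincreasing T0' dh (hmem T _ _ L0 HL).
have lipG p : exists K, forall s s', s <= s' -> G s p - G s' p <= K * (s' - s).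
  have [L L0 HL] := lipr p.
  exact: memory_degradation_lipschitz T0' dh (hmem T _ _ L0 HL).
(* The history up to s only sees times in [0, s], where [ub] and [u] agree on [O']. *)
have gammaG s x y : 0 <= s <= T -> O' x -> O' y -> gamma u y x s = G s (x, y).
  move=> sT Ox Oy; have /andP[s0 _] := sT.
  rewrite gammaE// /G clamp_id//; congr h; apply: hloc => s' /andP[s'0 s's].
  have s'T : 0 <= s' <= T by rewrite s'0 (le_trans s's)//; case/andP: sT.
  by rewrite /r /scaled_strain /strain /= !ubE.
(* Interior times only: [derive1] is two-sided, and outside [0, T] the factor [gamma] is not
   controlled, while [G] is constant. *)
have damage s x y : 0 < s < T -> O' x -> O' y ->
    derive1 (gamma u y x) s * g (scaled_strain y x (u s)) =
    - Cp * - derive1 (G^~ (x, y)) s.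
  move=> /[dup] s0T /andP[s0 sT] Ox Oy.
  have [L L0 HL] := lipr (x, y).
  have := memory_degradation_damage L0 HL (hmem T _ _ L0 HL) (potential_right hg) s0T.
  rewrite -/(G^~ (x, y)) mulrNN [RHS]mulrC => <-.
  rewrite (@derive1_near_eq _ (gamma u y x) (G^~ (x, y))); last first.
    have : \near s, s \in `]0, T[ by apply: near_in_itvoo; rewrite in_itv/= s0.
    apply: filterS => s'; rewrite in_itv/= => /andP[s'0 s'T].
    by rewrite gammaG// !ltW.
  by congr (_ * g _); rewrite /r /scaled_strain /strain /= !ubE// !ltW.
pose k (p : 'rV[R]_d * 'rV[R]_d) := nonlocal_kernel Omega J eps p.2 p.1.
have mk : measurable_fun setT k := measurable_nonlocal_kernel mO hJ eps0.
have k0 p : 0 <= k p := nonlocal_kernel_ge0 Omega hJ eps0 p.2 p.1.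
have kB p := nonlocal_kernel_le Omega hJ eps0 p.2 p.1.
have core := iterated_damageZl mO mO Ooo Ooo mk k0 kB mG niG lipG
  (fun s p => h01 _) _ t0.
have ae_neq (a : R) : {ae @lebesgue_measure R, forall s, s != a}.
  exists [set a]; split => //; first by rewrite lebesgue_measure_set1.
  by move=> s /= /negP; rewrite negbK => /eqP.
have ae0T : {ae @lebesgue_measure R, forall s, s \in `[0, t] -> 0 < s < T}.
  move: (ae_neq 0) (ae_neq T); apply: filterS2.
    exact: (ae_filter_ringOfSetsType (@lebesgue_measure R)).
  move=> s s0 sT; rewrite in_itv/= => /andP[ss0 st].
  by rewrite !lt_neqAle eq_sym s0 ss0 sT (le_trans st).
(* [Cp] may have either sign, so it is kept apart from the nonnegative product to which Tonelli
   applies. *)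
transitivity (- \int[lebesgue_measure]_(s in `[0, t]) \int[lebesgue_rV d]_(x in Omega)
    \int[lebesgue_rV d]_(y in Omega) (- Cp * (k (x, y) * - derive1 (G^~ (x, y)) s))).
  rewrite /damage_energy.
  apply: (congr1 -%R).
  apply: Rintegral_ae_congr; move: ae0T; apply: filterS.
    exact: (ae_filter_ringOfSetsType (@lebesgue_measure R)).
  move=> s /[apply] s0T.
  apply: Rintegral_ae_congr; apply: filterS (aeN) => x Nx Ox.
  apply: Rintegral_ae_congr; apply: filterS (aeN) => y Ny Oy.
  by rewrite -mulrA damage//; rewrite mulrCA.
rewrite core mulNr opprK.
have mc : measurable_fun setT (fun p => k p * (G 0 p - G t p)).
  by apply: measurable_funM => //; exact: measurable_funB.
have c0 p : 0 <= k p * (G 0 p - G t p) by rewrite mulr_ge0// subr_ge0 niG.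
apply/esym; apply: etrans
  (@ge0_Rintegral2Zl _ _ _ _ R (lebesgue_rV d) (lebesgue_rV d) _ _ mO mO _ mc c0 Cp).
apply: Rintegral_ae_congr; apply: filterS2 (aeN) undamaged => x Nx Ux Ox.
apply: Rintegral_ae_congr; apply: filterS2 (aeN) (Ux Ox) => y Ny Uy Oy.
rewrite -!gammaG ?lexx ?t0//.
(* Bonds shorter than [eps] start undamaged; on the others the kernel vanishes. *)
have [xy|yx] := ltP (enorm (y - x)) eps.
  by rewrite Uy//; rewrite mulrCA mulrA.
by rewrite /k/= (nonlocal_kernel_far Omega hJ eps0)// !(mul0r, mulr0).
Qed.
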